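(* Let $d<\infty$ be a positive integer and let $F\in H^2_{\rm s}(\mathcal B(\mathbb C^d,\ell^2))$ be a co-outer operator function. Suppose that $F=\Theta G$, where $\Theta$ is an inner operator function and $G$ is an outer operator function. Then $\Theta$ is co-outer.
   Context: For separable Hilbert spaces $\mathcal H,\mathcal K$, $\mathcal B(\mathcal H,\mathcal K)$ is the space of bounded linear operators from $\mathcal H$ to $\mathcal K$, and $H^2_{\rm s}(\mathcal B(\mathcal H,\mathcal K))$ is the space of analytic $\mathcal B(\mathcal H,\mathcal K)$-valued functions $F$ on the unit disk such that $F(z)x\in H^2(\mathcal K)$ for every $x\in\mathcal H$. $F\in H^2_{\rm s}(\mathcal B(\mathcal H,\mathcal K))$ is inner if $F(\zeta)$ is isometric (i.e. $F(\zeta)^*F(\zeta)=I$) for almost all $\zeta$ in the unit circle $\mathbb T$. It is outer if the set $\{Fq: q \text{ is a polynomial in } H^2(\mathcal H)\}$ is dense in $H^2(\mathcal K)$. Separable Hilbert spaces are identified with $\ell^2$ or $\mathbb C^k$, and operator functions with (possibly infinite) matrix functions. A matrix function $F$ is co-outer if the transposed function $F^{\rm t}$ is outer. In the factorization $F=\Theta G$, $\Theta$ takes values in $\mathcal B(\mathcal E,\ell^2)$ and $G$ takes values in $\mathcal B(\mathbb C^d,\mathcal E)$ for a separable Hilbert space $\mathcal E$ (identified with some $\mathbb C^k$ or $\ell^2$). *)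

(* Defs.v *)
From mathcomp Require Import all_boot all_order all_algebra.
From mathcomp Require Import all_classical all_reals all_analysis.
From mathcomp Require Import complex.
From mathcomp Require summability.

Set Implicit Arguments.
Unset Strict Implicit.
Unset Printing Implicit Defensive.

Import Order.TTheory GRing.Theory Num.Theory.
Import numFieldNormedType.Exports.

Local Open Scope classical_set_scope.
Local Open Scope ring_scope.

(** A separable Hilbert space is given as [ell^2(I)] for a countable index type
    [I]: [I = nat] is [ell^2], [I = 'I_k] is [C^k]. A vector is a function
    [I -> R[i]] satisfying [ell2]; an operator from [ell^2(J)] to [ell^2(I)] is
    given by its matrix in the standard bases, [opmx R I J = I -> J -> R[i]]. *)

Definition opmx (R : realType) (I J : countType) := I -> J -> R[i].

Definition modulus (R : realType) (z : R[i]) : R := ComplexField.Normc.normc z.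

Definition in_disk (R : realType) (z : R[i]) : Prop := modulus z < 1.

Section Hilbert.
Variable R : realType.

(** The squared norm of a vector; it is [+oo] outside [ell^2(I)]. *)
Definition sqnorm (I : countType) (x : I -> R[i]) : \bar R :=
  \esum_(i in [set: I]) (modulus (x i) ^+ 2)%:E.

Definition ell2 (I : countType) (x : I -> R[i]) : Prop := (sqnorm x < +oo)%E.

(** Unordered sum (limit along the finite subsets of [J]); [^o] is there because
    the topology on a field is carried by its regular module. *)
Definition csum (J : countType) (a : J -> R[i]) : R[i] :=
  summability.sum (a : J -> R[i]^o).

Definition mxapp (I J : countType) (A : opmx R I J) (x : J -> R[i]) :
  I -> R[i] := fun i => csum (fun j => A i j * x j).

Definition mxmul (I K J : countType) (A : opmx R I K) (B : opmx R K J) :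
  opmx R I J := fun i j => csum (fun k => A i k * B k j).

Definition mxtr (I J : countType) (A : opmx R I J) : opmx R J I :=
  fun j i => A i j.

(** [A] is the matrix of a bounded operator [ell^2(J) -> ell^2(I)] of norm at
    most [M]. The summability clause ensures that [mxapp A x] is a genuine sum. *)
Definition opnorm_le (I J : countType) (A : opmx R I J) (M : R) : Prop :=
  0 <= M /\
  forall x : J -> R[i], ell2 x ->
    (forall i, summable [set: J] (fun j => (modulus (A i j * x j))%:E)) /\
    (sqnorm (mxapp A x) <= (M ^+ 2)%:E * sqnorm x)%E.

Definition bounded_op (I J : countType) (A : opmx R I J) : Prop :=
  exists M : R, opnorm_le A M.

Definition isometric (I J : countType) (V : opmx R I J) : Prop :=
  bounded_op V /\ forall x : J -> R[i], ell2 x -> sqnorm (mxapp V x) = sqnorm x.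

End Hilbert.

Section Hardy.
Variable R : realType.

(** [f(z) = sum_n z^n a_n] on the unit disk, with convergence in [ell^2(I)]. *)
Definition power_expansion (I : countType) (f : R[i] -> I -> R[i])
    (a : nat -> I -> R[i]) : Prop :=
  (forall n, ell2 (a n)) /\
  forall z : R[i], in_disk z ->
    sqnorm (fun i => f z i - \sum_(n < N) z ^+ n * a n i) @[N --> \oo] --> 0%E.

(** The Hardy space of analytic vector functions [f(z) = sum_n z^n a_n] with
    norm [||f||^2 = sum_n ||a_n||^2 < oo]. *)
Definition H2 (I : countType) (f : R[i] -> I -> R[i]) : Prop :=
  exists2 a : nat -> I -> R[i], power_expansion f a &
    (\sum_(0 <= n <oo) sqnorm (a n) < +oo)%E.

Definition H2norm_lt (I : countType) (f : R[i] -> I -> R[i]) (e : R) : Prop :=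
  exists2 a : nat -> I -> R[i], power_expansion f a &
    (\sum_(0 <= n <oo) sqnorm (a n) < (e ^+ 2)%:E)%E.

Definition H2poly (I : countType) (q : R[i] -> I -> R[i]) : Prop :=
  exists (N : nat) (c : nat -> I -> R[i]),
    (forall n, ell2 (c n)) /\
    q = (fun z i => \sum_(n < N) z ^+ n * c n i).

(** Power series expansion on the disk, convergent in operator norm. *)
Definition op_analytic (I J : countType) (F : R[i] -> opmx R I J) : Prop :=
  exists2 A : nat -> opmx R I J, (forall n, bounded_op (A n)) &
    forall z : R[i], in_disk z -> forall e : R, 0 < e ->
      \forall N \near \oo,
        opnorm_le (fun i j => F z i j - \sum_(n < N) z ^+ n * A n i j) e.

(** [F] lies in [H^2_s(B(ell^2(J), ell^2(I)))]. Only the values of [F] on the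
    open unit disk matter, here and below. *)
Definition H2s (I J : countType) (F : R[i] -> opmx R I J) : Prop :=
  [/\ forall z : R[i], in_disk z -> bounded_op (F z),
      op_analytic F &
      forall x : J -> R[i], ell2 x -> H2 (fun z => mxapp (F z) x)].

Definition circle_pt (t : R) : R[i] := Complex (cos t) (sin t).

(** [V] is the radial boundary value of [F] at [zeta], in the strong operator
    topology. *)
Definition boundary_value (I J : countType) (F : R[i] -> opmx R I J)
    (zeta : R[i]) (V : opmx R I J) : Prop :=
  bounded_op V /\
  forall x : J -> R[i], ell2 x ->
    sqnorm (fun i => mxapp (F (real_complex R r * zeta)) x i - mxapp V x i)
      @[r --> 1^'-] --> 0%E.

Definition inner (I J : countType) (F : R[i] -> opmx R I J) : Prop :=
  H2s F /\
  {ae (@lebesgue_measure R), forall t : R,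
     exists2 V : opmx R I J, boundary_value F (circle_pt t) V & isometric V}.

Definition outer (I J : countType) (F : R[i] -> opmx R I J) : Prop :=
  H2s F /\
  forall f : R[i] -> I -> R[i], H2 f -> forall e : R, 0 < e ->
    exists2 q : R[i] -> J -> R[i], H2poly q &
      H2norm_lt (fun z i => f z i - mxapp (F z) (q z) i) e.

Definition co_outer (I J : countType) (F : R[i] -> opmx R I J) : Prop :=
  outer (fun z => mxtr (F z)).

End Hardy.

(* Main.v *)
(* Write A for the transpose of G, so that the transpose of F is A times the
   transpose of Theta. Evaluation at 0 shows that E has d elements: G(0) has dense
   range in ell^2(E), and A(0) has dense range in C^d. Since G is outer there is a
   polynomial matrix B with B A close to the identity in H^2, and since F is
   co-outer there is a matrix M whose columns lie in the range of the transpose of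
   Theta with A M close to the identity in H^2. The identity
     det A det B (M A) = det (B A) + det B adj(A) (A M - 1) A
   then shows that, after replacing the scalar and right-hand factors by polynomials,
   the range contains vectors u close to a unit vector in the sense that the
   geometric mean of 1 + |u - e_j| over the circle is close to 1. Multiplying u by a
   polynomial approximating the outer function of modulus 2 / (1 + |u|^2) turns this
   into approximation in H^2. Means over the circle are taken over rotated grids of
   N-th roots of unity, for which Parseval's identity and Jensen's inequality are
   elementary. *)

Require Import Defs.
From mathcomp Require Import all_boot all_order all_algebra.
From mathcomp Require Import all_classical all_reals all_analysis.
From mathcomp Require Import complex.
From mathcomp Require Import all_fingroup cyclic separable cyclotomic ring lra.
From mathcomp Require summability.

Set Implicit Arguments.
Unset Strict Implicit.
Unset Printing Implicit Defensive.

Import Order.TTheory GRing.Theory Num.Theory.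
Import numFieldNormedType.Exports.

Local Open Scope ring_scope.

(** * The modulus *)

Section Modulus.
Variable R : realType.
Implicit Types z x y : R[i].
Local Notation md := (@modulus R).

(** The remainder [det B adj(A) (A M - 1) A] need not be small in H^2: the factor [A M - 1] is, but
    it is multiplied by products of [d] entries of [A], each only square-integrable. What survives
    such products is the geometric mean of [1 + x]. It stays near 1 when [x] is a factor small in
    mean times a fixed power of a factor bounded in mean. The determinants enter as multipliers and
    never as divisors, so the vectors obtained are [M] times a polynomial vector and remain in the
    range. The modulus [2 / (1 + |u|^2)] is dictated by [2 |u| <= 1 + |u|^2], with equality at
    [|u| = 1]: the multiplier phi makes [phi u] essentially a contraction. Then [||phi u - e_j||^2 =
    ||phi u||^2 + 1 - 2 Re (phi u_j)(0)], and a value at 0 close to 1 is enough. Jensen's inequality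
    yields a grid whose rotation cannot be prescribed, so every mean is bounded for all rotations at
    once. *)

Lemma modulusE z : (md z)%:C%C = `|z|.
Proof. by []. Qed.

Lemma modulus_ge0 z : 0 <= md z.
Proof. by rewrite -(@lecR R) modulusE; exact: normr_ge0. Qed.

Lemma modulus0 : md 0 = 0. Proof. exact: ComplexField.Normc.normc0. Qed.
Lemma modulus1 : md 1 = 1. Proof. exact: ComplexField.Normc.normc1. Qed.

Lemma modulusM x y : md (x * y) = md x * md y.
Proof. exact: ComplexField.Normc.normcM. Qed.

Lemma modulusD x y : md (x + y) <= md x + md y.
Proof. exact: le_normcD. Qed.

Lemma modulusN x : md (- x) = md x.
Proof. exact: normcN. Qed.

Lemma modulusB x y : md (x - y) <= md x + md y.
Proof. by rewrite (le_trans (modulusD _ _)) ?modulusN. Qed.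

Lemma modulusBC x y : md (x - y) = md (y - x).
Proof. by rewrite -modulusN opprB. Qed.

Lemma modulusV x : md x^-1 = (md x)^-1.
Proof. exact: ComplexField.Normc.normcV. Qed.

Lemma modulusX x n : md (x ^+ n) = md x ^+ n.
Proof. by elim: n => [|n IH]; rewrite ?modulus1// !exprS modulusM IH. Qed.

Lemma modulus_eq0 z : (md z == 0) = (z == 0).
Proof.
by apply/eqP/eqP => [|->]; [exact: ComplexField.Normc.eq0_normc|exact: modulus0].
Qed.

Lemma modulus_sum I (r : seq I) (P : pred I) (F : I -> R[i]) :
  md (\sum_(i <- r | P i) F i) <= \sum_(i <- r | P i) md (F i).
Proof.
elim/big_ind2: _ => [|x a y b xa yb|//]; first by rewrite modulus0.
by apply: le_trans (modulusD _ _) _; rewrite lerD.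
Qed.

Lemma modulus_prod I (r : seq I) (P : pred I) (F : I -> R[i]) :
  md (\prod_(i <- r | P i) F i) = \prod_(i <- r | P i) md (F i).
Proof. by apply: big_morph => [x y|]; [exact: modulusM|exact: modulus1]. Qed.

Lemma modulus_real (a : R) : 0 <= a -> md a%:C%C = a.
Proof.
by move=> a0; apply: (@complexI R); rewrite modulusE ger0_norm// lecR.
Qed.

Lemma modulus_real_sqr (a : R) : md a%:C%C ^+ 2 = a ^+ 2.
Proof.
have [a0|/ltW a0] := leP 0 a; first by rewrite modulus_real.
by rewrite -modulusN -rmorphN modulus_real ?oppr_ge0// sqrrN.
Qed.

Lemma modulus_conj z : md z^* = md z.
Proof. by apply: (@complexI R); rewrite !modulusE norm_conjC. Qed.

Lemma modulus_sqr z : (md z ^+ 2)%:C%C = z * z^*.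
Proof. by rewrite rmorphXn /= modulusE normCK. Qed.

Lemma modulus_phase x : exists2 c, md c = 1 & c * x = (md x)%:C%C.
Proof.
have [->|x0] := eqVneq x 0; first by exists 1; rewrite ?modulus1// modulus0 mulr0.
have mx0 : md x != 0 by rewrite modulus_eq0.
exists ((md x)%:C%C / x).
  by rewrite modulusM modulusV modulus_real ?modulus_ge0// divff.
by rewrite mulfVK.
Qed.

End Modulus.

(** * Roots of unity and square-summable sequences *)

Section Grid.
Variable R : realType.
Local Notation C := R[i].
Local Notation md := (@modulus R).
Implicit Types p q : {poly C}.

(** In characteristic 0 the polynomial [X^N - 1] is separable, so over a closed field it has [N]
    distinct roots; [N] distinct [N]-th roots of unity always include a primitive one. *)
Lemma prim_root_exists N : (0 < N)%N -> exists w : C, N.-primitive_root w.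
Proof.
move=> N0; have [r Dp] := closed_field_poly_normal ('X^N - 1 : {poly C}).
move: Dp; rewrite (monicP _) ?monicXnsubC// scale1r => Dp.
have sr : (N < (size r).+1)%N by rewrite -(size_prod_XsubC r id) -Dp size_XnsubC.
have Ur : uniq r.
  rewrite -separable_prod_XsubC -Dp; apply: separable_Xn_sub_1.
  by rewrite pnatr_eq0 -lt0n.
have un : all N.-unity_root r by apply/allP => x; rewrite -root_prod_XsubC -Dp.
by have [w _ hw] := hasP (has_prim_root N0 un Ur sr); exists w.
Qed.

Section Root.
Variables (N : nat) (w : C).
Hypothesis hw : N.-primitive_root w.

Let N0 : (0 < N)%N. Proof. exact: prim_order_gt0 hw. Qed.

Lemma modulus_prim_root : md w = 1.
Proof.
have /(congr1 md) := prim_expr_order hw; rewrite modulusX modulus1 => /eqP.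
by rewrite pexpr_eq1// ?modulus_ge0// => /eqP.
Qed.

Lemma grid_mod (e : C) (i : nat) : md e = 1 -> md (e * w ^+ i) = 1.
Proof. by move=> e1; rewrite modulusM modulusX modulus_prim_root e1 expr1n mulr1. Qed.

Lemma sum_prim_root (n k : nat) : (n < N)%N -> (k < N)%N ->
  \sum_(i < N) (w ^+ n / w ^+ k) ^+ i = (N * (n == k))%:R :> C.
Proof.
move=> nN kN; have wk : w ^+ k != 0.
  by rewrite -modulus_eq0 modulusX modulus_prim_root expr1n oner_eq0.
have [->|nk] := eqVneq n k.
  rewrite muln1 (eq_bigr (fun=> 1)) ?sumr_const ?card_ord// => i _.
  by rewrite divff// expr1n.
rewrite muln0; apply/eqP.
have : (w ^+ n / w ^+ k - 1) * \sum_(i < N) (w ^+ n / w ^+ k) ^+ i == 0.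
  by rewrite -subrX1 expr_div_n -!exprM ![(_ * N)%N]mulnC !exprM
     !(prim_expr_order hw) !expr1n divr1 subrr.
rewrite mulf_eq0 => /orP[|//]; rewrite subr_eq0 => /eqP h; exfalso; move: nk.
move: h => /(congr1 (fun x => x * w ^+ k)); rewrite mulfVK// mul1r => /eqP.
by rewrite (eq_prim_root_expr hw) !modn_small// => /eqP ->; rewrite eqxx.
Qed.

(** Orthogonality of the characters of Z/N. The bound on the size excludes aliasing between
    exponents equal modulo [N], and the rotation [e] only multiplies each coefficient by a
    unimodular number. *)
Lemma grid_parseval p (e : C) : (size p <= N)%N -> md e = 1 ->
  \sum_(i < N) md p.[e * w ^+ i] ^+ 2 = N%:R * \sum_(n < N) md p`_n ^+ 2.
Proof.
move=> sp e1; apply: (@complexI R).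
have ec n : e ^+ n * (e^* ) ^+ n = 1.
  by rewrite -exprMn -modulus_sqr e1 expr1n expr1n.
have wV n : (w ^+ n)^* = (w ^+ n)^-1.
  have h : w ^+ n * (w ^+ n)^* = 1 by rewrite -modulus_sqr modulusX modulus_prim_root !expr1n.
  have wn0 : w ^+ n != 0 by apply/eqP => w0; move: h; rewrite w0 mul0r => /esym/eqP; rewrite oner_eq0.
  by rewrite -[LHS](mulKf wn0) h mulr1.
rewrite rmorph_sum rmorphM /= rmorph_sum /= rmorph_nat.
transitivity (\sum_(i < N) \sum_(n < N) \sum_(k < N)
    (p`_n * (p`_k)^* * (e ^+ n * (e ^+ k)^* ) * (w ^+ n / w ^+ k) ^+ i)).
  apply: eq_bigr => i _; rewrite modulus_sqr (horner_coef_wide _ sp).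
  rewrite rmorph_sum /= mulr_suml; apply: eq_bigr => n _.
  rewrite mulr_sumr; apply: eq_bigr => k _.
  rewrite !rmorphM !rmorphXn !rmorphM !rmorphXn /= !exprMn.
  rewrite -[X in _ * (_ * (_ * X))]exprM.
  have -> : w^* ^+ (i * k) = (w ^+ k)^-1 ^+ i.
    by rewrite -wV rmorphXn /= -exprM mulnC.
  rewrite -exprM mulnC exprM.
  ring.
rewrite exchange_big /= mulr_sumr; apply: eq_bigr => n _.
rewrite exchange_big /=.
under eq_bigr do rewrite -mulr_sumr.
rewrite [LHS](bigD1 n)//= [X in _ + X]big1 ?addr0; last first.
  move=> k kn; rewrite sum_prim_root// eq_sym.
  by rewrite (_ : (_ == _ :> nat) = false) ?muln0 ?mulr0//; apply/negbTE.
rewrite sum_prim_root// eqxx muln1 modulus_sqr rmorphXn /= ec.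
by rewrite mulr1 mulrC.
Qed.

End Root.
End Grid.

(** * Finite Cauchy-Schwarz and Minkowski inequalities, geometric decay *)

Section Sums.
Variable R : realType.

Lemma CauchySchwarz_sum (I : Type) (r : seq I) (x y : I -> R) (X Y : R) :
  0 <= X -> 0 <= Y -> \sum_(i <- r) x i ^+ 2 <= X ^+ 2 ->
  \sum_(i <- r) y i ^+ 2 <= Y ^+ 2 -> \sum_(i <- r) x i * y i <= X * Y.
Proof.
move=> X0 Y0 hx hy; have [|s0] := leP (\sum_(i <- r) x i * y i) 0.
  by move=> /le_trans; apply; rewrite mulr_ge0.
rewrite -(@ler_pXn2r _ 2)// ?nnegrE ?mulr_ge0//; last exact: ltW.
rewrite exprMn; apply: le_trans (ler_pM _ _ hx hy);
  [|by apply: sumr_ge0 => i _; exact: sqr_ge0..].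
(* Lagrange's identity: this double sum is twice the defect in the Cauchy-Schwarz inequality. *)
have : 0 <= \sum_(i <- r) \sum_(j <- r) (x i * y j - x j * y i) ^+ 2.
  by apply: sumr_ge0 => i _; apply: sumr_ge0 => j _; exact: sqr_ge0.
have -> : \sum_(i <- r) \sum_(j <- r) (x i * y j - x j * y i) ^+ 2 =
  (\sum_(i <- r) x i ^+ 2) * (\sum_(j <- r) y j ^+ 2) *+ 2 -
  (\sum_(i <- r) x i * y i) ^+ 2 *+ 2.
  transitivity (\sum_(i <- r) \sum_(j <- r) (x i ^+ 2 * y j ^+ 2) +
    \sum_(i <- r) \sum_(j <- r) (x j ^+ 2 * y i ^+ 2) -
    \sum_(i <- r) \sum_(j <- r) ((x i * y i) * (x j * y j)) *+ 2).
    rewrite -sumrN -!big_split /=; apply: eq_bigr => i _.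
    rewrite -sumrN -!big_split /=; apply: eq_bigr => j _; ring.
  rewrite (exchange_big _ _ _ _ _ (fun i j => x j ^+ 2 * y i ^+ 2)) /=.
  rewrite -mulr2n; congr (_ *+ 2 - _).
    by rewrite mulr_suml; apply: eq_bigr => i _; rewrite mulr_sumr.
  rewrite expr2 mulr_suml -sumrMnl; apply: eq_bigr => i _.
  by rewrite mulr_sumr -sumrMnl.
rewrite subr_ge0; rewrite !mulr2n; lra.
Qed.

Lemma Minkowski_sum (I : Type) (r : seq I) (x y : I -> R) (X Y : R) :
  0 <= X -> 0 <= Y -> \sum_(i <- r) x i ^+ 2 <= X ^+ 2 ->
  \sum_(i <- r) y i ^+ 2 <= Y ^+ 2 ->
  \sum_(i <- r) (x i + y i) ^+ 2 <= (X + Y) ^+ 2.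
Proof.
move=> X0 Y0 hx hy; have h := CauchySchwarz_sum X0 Y0 hx hy.
have -> : \sum_(i <- r) (x i + y i) ^+ 2 = \sum_(i <- r) x i ^+ 2 +
    \sum_(i <- r) y i ^+ 2 + (\sum_(i <- r) x i * y i) *+ 2.
  by rewrite -sumrMnl -!big_split /=; apply: eq_bigr => i _; ring.
by rewrite mulr2n; nra.
Qed.

Lemma expr_le_small (x e : R) : 0 <= x -> x < 1 -> 0 < e ->
  exists K, forall n, (K <= n)%N -> x ^+ n <= e.
Proof.
move=> x0 x1 e0.
(* A form of Bernoulli's inequality; it gives decay of order [1 / n] without logarithms. *)
have H n : x ^+ n * (1 + n%:R * (1 - x)) <= 1.
  elim: n => [|n IH]; first by rewrite expr0 mul0r addr0 mulr1.
  apply: le_trans IH; rewrite exprS [x * _]mulrC -mulrA ler_wpM2l ?exprn_ge0//.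
  rewrite -natr1 -subr_ge0.
  have -> : 1 + n%:R * (1 - x) - x * (1 + (n%:R + 1) * (1 - x)) =
    (n%:R + 1) * (1 - x) ^+ 2 by ring.
  by rewrite mulr_ge0 ?sqr_ge0// addr_ge0.
have t0 : 0 < (1 - x)^-1 / e by rewrite divr_gt0// invr_gt0 subr_gt0.
exists (Num.bound ((1 - x)^-1 / e)) => n hn.
have : (1 - x)^-1 / e < n%:R.
  by apply: lt_le_trans (archi_boundP (ltW t0)) _; rewrite ler_nat.
rewrite ltr_pdivrMr// mulrC -[X in X < _]mulr1 ltr_pdivrMl ?subr_gt0// => h1.
have := H n; have := exprn_ge0 n x0; set y := x ^+ n => y0 hy.
have : 0 <= (1 - x) * n%:R by rewrite mulr_ge0// subr_ge0 ltW.
by nra.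
Qed.

End Sums.

(** * Square-summable coefficients and values on the circle *)

Section Hardy2.
Variable R : realType.
Local Notation C := R[i].
Local Notation md := (@modulus R).
Implicit Types (p q g : {poly C}) (a b : nat -> C).

(** A bound on the H^2 norm through partial sums, so that no infinite sum has to be evaluated. [K]
    enters by its square only, which is why [0 <= K] appears as a separate hypothesis. *)
Definition l2_le a (K : R) := forall n, \sum_(i < n) md (a i) ^+ 2 <= K ^+ 2.

Lemma l2_le_ext a b K : a =1 b -> l2_le a K -> l2_le b K.
Proof. by move=> ab h n; under eq_bigr do rewrite -ab. Qed.

Lemma l2_le_le a K L : 0 <= K -> K <= L -> l2_le a K -> l2_le a L.
Proof.
move=> K0 KL h n; apply: le_trans (h n) _.
by rewrite ler_sqr ?nnegrE// (le_trans K0).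
Qed.

Lemma l2_le_dom a b K : (forall i, md (b i) <= md (a i)) -> l2_le a K -> l2_le b K.
Proof.
move=> ba h n; apply: le_trans (h n); apply: ler_sum => i _.
by rewrite ler_sqr ?nnegrE ?modulus_ge0.
Qed.

Lemma l2_leD a b K L : 0 <= K -> 0 <= L -> l2_le a K -> l2_le b L ->
  l2_le (fun n => a n + b n) (K + L).
Proof.
move=> K0 L0 ha hb n; apply: le_trans (Minkowski_sum K0 L0 (ha n) (hb n)).
apply: ler_sum => i _; rewrite ler_sqr ?nnegrE ?addr_ge0 ?modulus_ge0//.
exact: modulusD.
Qed.

Lemma l2_le_coef a K n : 0 <= K -> l2_le a K -> md (a n) <= K.
Proof.
move=> K0 /(_ n.+1); rewrite big_ord_recr /= => h.
rewrite -ler_sqr ?nnegrE ?modulus_ge0//; apply: le_trans h.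
by rewrite lerDr sumr_ge0// => i _; exact: sqr_ge0.
Qed.

Lemma l2_le_trunc a K n : l2_le a K -> l2_le (fun i => (\poly_(k < n) a k)`_i) K.
Proof.
move=> h; apply: l2_le_dom h => i; rewrite coef_poly; case: ifP => // _.
by rewrite modulus0 modulus_ge0.
Qed.

Lemma grid_hle N (w e : C) p K : N.-primitive_root w -> md e = 1 ->
  (size p <= N)%N -> l2_le (fun n => p`_n) K ->
  \sum_(i < N) md p.[e * w ^+ i] ^+ 2 <= N%:R * K ^+ 2.
Proof.
by move=> hw e1 sp h; rewrite (grid_parseval hw)// ler_wpM2l.
Qed.

(** By Parseval the mean of [|p|^2] over a fine grid is at least the square of [|p(0)|], so some
    grid point does at least as well as 0. *)
Lemma max_principle p : exists2 e, md e = 1 & md p`_0 <= md p.[e].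
Proof.
have [w hw] := @prim_root_exists R (size p).+1 isT.
have h := grid_parseval hw (leqnSn _) (modulus1 R).
have [/existsP[i hi]|/existsPn hn] :=
    boolP [exists i : 'I_(size p).+1, md p`_0 <= md p.[1 * w ^+ i]].
  by exists (1 * w ^+ i) => //; rewrite (grid_mod hw) ?modulus1.
suff : \sum_(i < (size p).+1) md p.[1 * w ^+ i] ^+ 2 <
    (size p).+1%:R * \sum_(n < (size p).+1) md p`_n ^+ 2 by rewrite h ltxx.
apply: (@lt_le_trans _ _ ((size p).+1%:R * md p`_0 ^+ 2)); last first.
  rewrite ler_wpM2l// big_ord_recl lerDl sumr_ge0// => i _; exact: sqr_ge0.
rewrite mulr_natl -[X in _ *+ X](card_ord (size p).+1) -sumr_const.
apply: ltr_sum => [|i _]; first by apply/hasP; exists ord0; rewrite ?mem_index_enum.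
by rewrite ltr_sqr ?nnegrE ?modulus_ge0// ltNge hn.
Qed.

(* The maximum principle for [\prod_i p(w^i z)] gives Jensen's inequality on a
   suitable rotation of the grid, without error term. *)
Lemma Jensen_grid N (w : C) p : exists2 e, md e = 1 &
  md p`_0 ^+ N <= \prod_(i < N) md p.[e * w ^+ i].
Proof.
have [e e1 he] := max_principle (\prod_(i < N) (p \Po (w ^+ i *: 'X))).
exists e => //; move: he; rewrite -horner_coef0 !horner_prod !modulus_prod.
rewrite (eq_bigr (fun=> md p`_0)); last first.
  by move=> i _; rewrite horner_comp hornerZ hornerX mulr0 horner_coef0.
rewrite prodr_const card_ord => /le_trans; apply.
rewrite le_eqVlt; apply/orP; left; apply/eqP/eq_bigr => i _.
by rewrite horner_comp hornerZ hornerX mulrC.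
Qed.

Lemma l2_le_sup p S : (forall z, md z = 1 -> md p.[z] <= S) ->
  l2_le (fun n => p`_n) S.
Proof.
move=> h n; set N := (maxn n (size p)).+1.
have [w hw] := @prim_root_exists R N isT.
have sp : (size p <= N)%N by rewrite leqW// leq_maxr.
apply: (@le_trans _ _ (\sum_(i < N) md p`_i ^+ 2)).
  have nN : (n <= N)%N by rewrite leqW// leq_maxl.
  rewrite -!(big_mkord xpredT (fun i => md p`_i ^+ 2)) (big_cat_nat (n := n) (p := N))//=.
  by rewrite lerDl sumr_ge0// => i _; exact: sqr_ge0.
have S0 : 0 <= S by apply: le_trans (h 1 (modulus1 R)); exact: modulus_ge0.
have N0 : 0 < N%:R :> R by rewrite ltr0n.
rewrite -(ler_pM2l N0) -(grid_parseval hw sp (modulus1 R)) mulr_natl.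
rewrite -[X in _ *+ X](card_ord N) -sumr_const; apply: ler_sum => i _.
rewrite ler_sqr ?nnegrE ?modulus_ge0//; apply: h.
by rewrite (grid_mod hw)// modulus1.
Qed.

(** The first [n] coefficients of the product involve only the first [n] entries of [a], so [a] may
    be replaced by a polynomial. The bound is then pointwise on a grid fine enough for Parseval on
    both sides. *)
Lemma l2_le_mulp p a S K : 0 <= K ->
  (forall z, md z = 1 -> md p.[z] <= S) -> l2_le a K ->
  l2_le (fun n => \sum_(i < n.+1) p`_i * a (n - i)%N) (S * K).
Proof.
move=> K0 hp ha n; set g := \poly_(i < n) a i.
have S0 : 0 <= S by apply: le_trans (hp 1 (modulus1 R)); exact: modulus_ge0.
rewrite (eq_bigr (fun i : 'I_n => md (p * g)`_i ^+ 2)); last first.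
  move=> i _; rewrite coefM; congr (md _ ^+ 2); apply: eq_bigr => k _.
  by rewrite coef_poly (leq_ltn_trans (leq_subr _ _)).
set N := (maxn n (size (p * g)%R + size g)%N).+1.
have [w hw] := @prim_root_exists R N isT.
have sp : (size (p * g)%R <= N)%N.
  by rewrite leqW// leq_max leq_addr orbT.
have sg : (size g <= N)%N by rewrite leqW// leq_max leq_addl orbT.
apply: (@le_trans _ _ (\sum_(i < N) md (p * g)`_i ^+ 2)).
  have nN : (n <= N)%N by rewrite leqW// leq_maxl.
  rewrite -!(big_mkord xpredT (fun i => md (p * g)`_i ^+ 2)) (big_cat_nat (n := n) (p := N))//=.
  by rewrite lerDl sumr_ge0// => i _; exact: sqr_ge0.
have N0 : 0 < N%:R :> R by rewrite ltr0n.
rewrite -(ler_pM2l N0) -(grid_parseval hw sp (modulus1 R)).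
apply: (@le_trans _ _ (S ^+ 2 * \sum_(i < N) md g.[1 * w ^+ i] ^+ 2)).
  rewrite mulr_sumr; apply: ler_sum => i _.
  rewrite hornerM modulusM exprMn ler_wpM2r ?sqr_ge0//.
  rewrite ler_sqr ?nnegrE ?modulus_ge0//; apply: hp.
  by rewrite (grid_mod hw)// modulus1.
rewrite exprMn mulrCA ler_wpM2l ?sqr_ge0//.
by apply: (grid_hle hw (modulus1 R) sg); exact: l2_le_trunc.
Qed.

End Hardy2.

(** * Outer multipliers *)

Section Smirnov.
Variable R : realType.
Local Notation C := R[i].
Local Notation md := (@modulus R).
Implicit Types (p q g : {poly C}).

(* Zeros inside the disk are reflected: [|z - b| = |1 - b^* z|] for [|z| = 1]. *)
Lemma circle_factor p : (forall z, md z = 1 -> p.[z] != 0) ->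
  exists (c : C) (bs : seq C), [/\ c != 0, {in bs, forall b, md b < 1} &
    forall z, md z = 1 -> md p.[z] = md c * \prod_(b <- bs) md (1 - b * z)].
Proof.
have [r ->] := closed_field_poly_normal p => nz.
have c0 : lead_coef p != 0.
  apply/eqP => c0; have := nz 1 (modulus1 R).
  by rewrite c0 scale0r horner0 eqxx.
have ar a : a \in r -> md a != 1.
  move=> ar; apply/eqP => /nz; rewrite hornerZ mulf_eq0 negb_or c0 /=.
  by rewrite -/(root _ _) root_prod_XsubC ar.
elim: r (lead_coef p) c0 ar {nz} => [|a r IH] c c0 ar.
  by exists c, [::]; split => // z _; rewrite !big_nil alg_polyC hornerC mulr1.
have ar' b : b \in r -> md b != 1 by move=> br; apply: ar; rewrite inE br orbT.
have [{}IH a1] := (IH, ar a (mem_head _ _)).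
case: (ltgtP (md a) 1) a1 => // a1 _.
  have [c' [bs [c'0 hbs H]]] := IH c c0 ar'.
  exists c', (a^* :: bs); split => //.
    by move=> b; rewrite inE => /predU1P[->|/hbs//]; rewrite modulus_conj.
  move=> z z1; rewrite !big_cons hornerZ hornerM mulrCA modulusM -hornerZ H//.
  rewrite mulrCA; congr (_ * (_ * _)); rewrite hornerXsubC.
  have zz : z * z^* = 1 by rewrite -modulus_sqr z1 expr1n.
  have -> : 1 - a^* * z = z * (z - a)^* by rewrite rmorphB mulrBr zz mulrC.
  by rewrite modulusM z1 mul1r modulus_conj.
(* A zero outside the disk is not reflected: [z - a = - a (1 - a^-1 z)], and the constant absorbs
   [- a]. *)
have a0 : a != 0 by rewrite -modulus_eq0 gt_eqF// (lt_trans _ a1).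
have ac0 : - a * c != 0 by rewrite mulf_neq0 ?oppr_eq0.
have [c' [bs [c'0 hbs H]]] := IH (- a * c) ac0 ar'.
exists c', (a^-1 :: bs); split => //.
  move=> b; rewrite inE => /predU1P[->|/hbs//]; rewrite modulusV.
  by rewrite invf_lt1// (lt_trans _ a1).
move=> z z1; rewrite !big_cons mulrCA -H//.
rewrite !hornerZ hornerM hornerXsubC -!modulusM; congr md.
by field.
Qed.

Lemma circle_inverse (bs : seq C) (e : R) : 0 < e ->
  {in bs, forall b, md b < 1} ->
  exists2 psi : {poly C}, psi`_0 = 1 & forall z, md z = 1 ->
    md psi.[z] * \prod_(b <- bs) md (1 - b * z) <= 1 + e.
Proof.
elim: bs e => [|b bs IH] e e0 hbs.
  exists 1; first by rewrite coef1.
  by move=> z _; rewrite big_nil mulr1 hornerC modulus1 lerDl ltW.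
pose e' := Num.min 1 (e / 3).
have e'0 : 0 < e' by rewrite lt_min ltr01/= divr_gt0.
have e'1 : e' <= 1 by rewrite ge_min lexx.
have e'e : e' * 3 <= e by rewrite -ler_pdivlMr// ge_min lexx orbT.
have hbs' : {in bs, forall b, md b < 1}.
  by move=> c cbs; apply: hbs; rewrite inE cbs orbT.
have [psi psi0 H] := IH e' e'0 hbs'.
have b1 : md b < 1 by apply: hbs; exact: mem_head.
have [K HK] := expr_le_small (modulus_ge0 b) b1 e'0.
pose g := \poly_(k < K.+1) b ^+ k.
exists (g * psi).
  by rewrite coef0M psi0 coef_poly expr0 mulr1.
move=> z z1; rewrite big_cons hornerM modulusM.
have -> : md g.[z] * md psi.[z] * (md (1 - b * z) *
    \prod_(j <- bs) md (1 - j * z)) =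
  md ((1 - b * z) * g.[z]) * (md psi.[z] * \prod_(j <- bs) md (1 - j * z)).
  rewrite modulusM; ring.
have -> : (1 - b * z) * g.[z] = 1 - (b * z) ^+ K.+1.
  rewrite horner_poly -opprB mulNr [X in _ * X](eq_bigr (fun i : 'I__ => (b * z) ^+ i)).
    by rewrite -subrX1 opprB.
  by move=> i _; rewrite exprMn.
have h1 : md (1 - (b * z) ^+ K.+1) <= 1 + e'.
  rewrite (le_trans (modulusB _ _))// modulus1 lerD2l modulusX modulusM z1 mulr1.
  exact: HK.
apply: (@le_trans _ _ ((1 + e') * (1 + e'))); last by nra.
apply: ler_pM => //; rewrite ?modulus_ge0// ?mulr_ge0 ?modulus_ge0//.
  by apply: prodr_ge0 => i _; exact: modulus_ge0.
exact: H.
Qed.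

Section Vector.
Variables (d : nat) (u : 'I_d -> {poly C}).

(** Twice the reciprocal of the modulus wanted for the multiplier. The summand 1 keeps it away from
    0, so that its polynomial form has no zeros on the circle. *)
Definition circle_weight z : R := 1 + \sum_i md (u i).[z] ^+ 2.

Lemma circle_weight_gt0 z : 0 < circle_weight z.
Proof.
by rewrite ltr_pwDl// sumr_ge0// => i _; exact: sqr_ge0.
Qed.

(** On the circle conjugation inverts [z], so [z^D] times the conjugate of [u i] is the polynomial
    with reversed conjugate coefficients. The factor [z^D] does not change the modulus. *)
Lemma circle_weight_poly : exists p, forall z, md z = 1 ->
  md p.[z] = circle_weight z.
Proof.
pose D := (\max_i size (u i))%N.
have sD i : (size (u i) <= D.+1)%N by rewrite leqW// leq_bigmax.
pose q i := \poly_(k < D.+1) ((u i)`_(D - k))^*.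
exists ('X^D + \sum_i u i * q i) => z z1.
have zz : z * z^* = 1 by rewrite -modulus_sqr z1 expr1n.
have qz i : (q i).[z] = z ^+ D * ((u i).[z])^*.
  rewrite horner_poly (horner_coef_wide _ (sD i)) rmorph_sum mulr_sumr /=.
  rewrite (reindex_inj rev_ord_inj) /=; apply: eq_bigr => k _.
  have kD : (k <= D)%N by rewrite -ltnS.
  rewrite subSS (subKn kD) rmorphM rmorphXn mulrCA; congr (_ * _).
  have -> : z ^+ D = z ^+ (D - k) * z ^+ k by rewrite -exprD subnK.
  by rewrite -mulrA -exprMn zz expr1n mulr1.
rewrite hornerD hornerXn horner_sum.
rewrite (eq_bigr (fun i => z ^+ D * (md (u i).[z] ^+ 2)%:C%C)); last first.
  by move=> i _; rewrite hornerM qz mulrCA modulus_sqr.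
rewrite -mulr_sumr -[X in X + _]mulr1 -mulrDr modulusM modulusX z1 expr1n mul1r.
have -> : 1 + \sum_i (md (u i).[z] ^+ 2)%:C%C = (circle_weight z)%:C%C.
  by rewrite /circle_weight rmorphD rmorph1 rmorph_sum.
by rewrite modulus_real// ltW// circle_weight_gt0.
Qed.

Variables (j : 'I_d).

Definition deviation z : R := \sum_i md ((u i).[z] - (i == j)%:R).

Lemma deviation_ge0 z : 0 <= deviation z.
Proof. by rewrite sumr_ge0// => i _; exact: modulus_ge0. Qed.

Lemma circle_weight_le z : circle_weight z <= 2 * (1 + deviation z) ^+ 2.
Proof.
have h : \sum_i md (u i).[z] ^+ 2 <= (1 + deviation z) ^+ 2.
  have h1 : \sum_i md (u i).[z] <= 1 + deviation z.
    have -> : 1 + deviation z = \sum_i (md (i == j)%:R + md ((u i).[z] - (i == j)%:R)).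
      rewrite big_split /= (bigD1 j)//= eqxx modulus1 big1 ?addr0// => i /negbTE ->.
      exact: modulus0.
    apply: ler_sum => i _; apply: le_trans (modulusD _ _).
    by rewrite addrC subrK.
  apply: (@le_trans _ _ ((\sum_i md (u i).[z]) ^+ 2)).
    rewrite expr2 mulr_suml; apply: ler_sum => i _; rewrite expr2 ler_wpM2l ?modulus_ge0//.
    by rewrite (bigD1 i)//= lerDl sumr_ge0// => k _; exact: modulus_ge0.
  rewrite ler_sqr// ?nnegrE ?addr_ge0 ?deviation_ge0//.
  by rewrite sumr_ge0// => k _; exact: modulus_ge0.
have := deviation_ge0 z; rewrite /circle_weight; nra.
Qed.

(* [psi] approximates the outer function of modulus [2 / (1 + |u|^2)]. Then
   [|psi * u| <= 1 + k] on the circle, while Jensen's inequality keeps the [j]-th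
   entry of [psi * u] at 0 close to 1 in modulus. *)
Lemma outer_multiplier N (w : C) (k e : R) : N.-primitive_root w ->
  0 < k -> k <= 1 -> 0 <= e -> 9 * k <= e ^+ 2 ->
  (forall z, md z = 1 -> \prod_(i < N) (1 + deviation (z * w ^+ i)) <= (1 + k) ^+ N) ->
  exists2 psi : {poly C}, (forall z, md z = 1 -> md psi.[z] <= 4) &
    forall i, l2_le (fun n => (psi * u i - (i == j)%:R%:P)`_n) e.
Proof.
move=> hw k0 k1 e0 ke H.
have N0 := prim_order_gt0 hw.
have [p hp] := circle_weight_poly.
have [c [bs [c0 hbs hc]]] : exists (c : C) (bs : seq C), [/\ c != 0,
    {in bs, forall b, md b < 1} &
    forall z, md z = 1 -> md p.[z] = md c * \prod_(b <- bs) md (1 - b * z)].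
  apply: circle_factor => z /hp h; rewrite -modulus_eq0 h gt_eqF//.
  exact: circle_weight_gt0.
(* [c] is the value at 0 of [c \prod (1 - b z)], whose modulus on the circle is the weight; Jensen
   bounds it by the geometric mean of the weight. *)
have cle : md c <= 2 * (1 + k) ^+ 2.
  have [z z1] := Jensen_grid N w (c *: \prod_(b <- bs) (1 - b *: 'X)).
  rewrite coefZ -horner_coef0 horner_prod big1 ?mulr1; last first.
    by move=> b _; rewrite hornerD hornerN hornerZ hornerX hornerC mulr0 subr0.
  move=> h; rewrite -(@ler_pXn2r _ N) ?nnegrE ?modulus_ge0//; last first.
    by rewrite mulr_ge0// sqr_ge0.
  apply: le_trans h _.
  rewrite (eq_bigr (fun i : 'I_N => circle_weight (z * w ^+ i))); last first.
    move=> i _; have z1' := grid_mod hw i z1.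
    rewrite -hp// hc// hornerZ modulusM horner_prod modulus_prod.
    by congr (_ * _); apply: eq_bigr => b _; rewrite !hornerE.
  apply: (@le_trans _ _ (\prod_(i < N) (2 * (1 + deviation (z * w ^+ i)) ^+ 2))).
    by apply: ler_prod => i _; rewrite circle_weight_le ltW// circle_weight_gt0.
  rewrite big_split /= prodr_const card_ord exprMn ler_wpM2l ?exprn_ge0//.
  rewrite prodrXl -exprM mulnC exprM; apply: lerXn2r; last exact: H.
    by rewrite nnegrE prodr_ge0// => i _; rewrite addr_ge0 ?deviation_ge0.
  by rewrite nnegrE exprn_ge0// addr_ge0// ltW.
have u0 : md ((u j)`_0 - 1) <= k.
  (* The phase [t] makes [t (u j - 1) + 1] take the value [1 + |u_j(0) - 1|] at 0, while its modulus
     on the circle is at most [1 + deviation]. *)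
  have [t t1 ht] := modulus_phase ((u j)`_0 - 1).
  have [z z1] := Jensen_grid N w (t *: (u j - 1) + 1).
  have -> : (t *: (u j - 1) + 1)`_0 = (md ((u j)`_0 - 1) + 1)%:C%C.
    by rewrite coefD coefZ coefB coef1 eqxx ht rmorphD rmorph1.
  rewrite modulus_real ?addr_ge0 ?modulus_ge0// => h.
  have : md ((u j)`_0 - 1) + 1 <= 1 + k; last by rewrite addrC lerD2l.
  have k0' := ltW k0.
  have k1' : 0 <= 1 + k by rewrite addr_ge0// ltW.
  rewrite -(@ler_pXn2r _ N) ?nnegrE ?addr_ge0 ?modulus_ge0//.
  apply: le_trans h (le_trans _ (H z z1)).
  apply: ler_prod => i _; rewrite modulus_ge0 /= !hornerE.
  rewrite addrC (le_trans (modulusD _ _))// modulus1 lerD2l modulusM t1 mul1r.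
  rewrite /deviation (bigD1 j)//= eqxx lerDl sumr_ge0// => l _; exact: modulus_ge0.
have [psi psi0 hpsi] := circle_inverse k0 hbs.
have mc0 : 0 < md c by rewrite lt_def modulus_eq0 c0 modulus_ge0.
have [t t1 ht] := modulus_phase (u j)`_0.
(* [2 / |c|] is the modulus at 0 of the outer function of modulus [2 / (1 + |u|^2)]; the phase [t]
   makes [phi(0) u_j(0)] real and nonnegative. *)
pose phi := (t * (2 / md c)%:C%C) *: psi.
have phi0 : phi`_0 * (u j)`_0 = (2 / md c * md (u j)`_0)%:C%C.
  by rewrite coefZ psi0 mulr1 [RHS]rmorphM /= -ht mulrA; congr (_ * _); rewrite mulrC.
have phiw z : md z = 1 -> md phi.[z] * circle_weight z <= 2 * (1 + k).
  move=> z1; rewrite -hp// hc// hornerZ !modulusM t1 mul1r.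
  rewrite modulus_real ?divr_ge0 ?modulus_ge0//.
  set P := \prod_(_ <- _) _.
  have -> : 2 / md c * md psi.[z] * (md c * P) = 2 * (md psi.[z] * P).
    by field; rewrite gt_eqF.
  by rewrite ler_wpM2l// hpsi.
exists phi => [z z1|i n].
  have := phiw z z1; have : 1 <= circle_weight z.
    by rewrite lerDl sumr_ge0// => i _; exact: sqr_ge0.
  have := modulus_ge0 phi.[z]; nra.
pose g i := phi * u i.
pose M := (n + \max_i size (g i)).+1%N.
have gM i' : (size (g i') <= M)%N.
  apply: leqW; apply: leq_trans (leq_addl _ _).
  exact: (@leq_bigmax _ (fun i => size (g i))).
have [w' hw'] := @prim_root_exists R M isT.
have M0 : 0 < M%:R :> R by rewrite ltr0n.
have S : \sum_i \sum_(m < M) md (g i)`_m ^+ 2 <= (1 + k) ^+ 2.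
  rewrite -(ler_pM2l M0) mulr_sumr.
  under eq_bigr do rewrite -(grid_parseval hw' (gM _) (modulus1 R)).
  rewrite exchange_big /= mulr_natl -[X in _ *+ X](card_ord M) -sumr_const.
  apply: ler_sum => m _; set z := 1 * _.
  have z1 : md z = 1 by rewrite (grid_mod hw') ?modulus1.
  under eq_bigr do rewrite hornerM modulusM exprMn.
  rewrite -mulr_sumr; have := phiw z z1; rewrite /circle_weight.
  set s := \sum_i _ => hs.
  have s0 : 0 <= s by apply: sumr_ge0 => l _; exact: sqr_ge0.
  have f0 := modulus_ge0 phi.[z].
  (* [4 s <= (1 + s)^2] turns the bound on [|phi| (1 + |u|^2)] into one on [|phi u|]. *)
  have h1 : 4 * (md phi.[z] ^+ 2 * s) <= (md phi.[z] * (1 + s)) ^+ 2.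
    rewrite exprMn mulrCA ler_wpM2l ?sqr_ge0// -subr_ge0.
    have -> : (1 + s) ^+ 2 - 4 * s = (1 - s) ^+ 2 by ring.
    exact: sqr_ge0.
  have h2 : (md phi.[z] * (1 + s)) ^+ 2 <= (2 * (1 + k)) ^+ 2.
    have k0' := ltW k0.
    by rewrite ler_sqr ?nnegrE ?mulr_ge0 ?addr_ge0.
  have := le_trans h1 h2; rewrite exprMn; nra.
have key : \sum_i \sum_(m < M) md ((g i) - (i == j)%:R%:P)`_m ^+ 2 =
    \sum_i \sum_(m < M) md (g i)`_m ^+ 2 + 1 - 2 * (2 / md c * md (u j)`_0).
  have gj0 : (g j)`_0 = (2 / md c * md (u j)`_0)%:C%C by rewrite coef0M phi0.
  rewrite (bigD1 j)//= [in RHS](bigD1 j)//= big_ord_recl [in RHS]big_ord_recl.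
  rewrite eqxx coefB coefC eqxx gj0 /=.
  have -> : md ((2 / md c * md (u j)`_0)%:C%C - 1%:R) ^+ 2 =
      (2 / md c * md (u j)`_0 - 1) ^+ 2.
    by rewrite -[RHS]modulus_real_sqr rmorphB rmorph1.
  rewrite modulus_real_sqr.
  under eq_bigr do rewrite coefB coefC /= subr0.
  rewrite [X in _ + X = _](_ : _ = \sum_(i' | i' != j) \sum_(m < M) md (g i')`_m ^+ 2).
    by set r := 2 / md c * _; ring.
  apply: eq_bigr => i' /negbTE ij; apply: eq_bigr => m _.
  by rewrite ij coefB coefC if_same subr0.
have r0 : (1 - k) / (1 + k) ^+ 2 <= 2 / md c * md (u j)`_0.
  have k2 : 0 < (1 + k) ^+ 2 by rewrite exprn_gt0// addr_gt0.
  have h1 : (1 + k) ^- 2 <= 2 / md c.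
    by rewrite ler_pdivlMr// ler_pdivrMl// mulrC.
  have k20 := ltW k2.
  rewrite mulrC; apply: ler_pM; rewrite ?subr_ge0 ?invr_ge0//.
  have : md 1 <= md (u j)`_0 + md ((u j)`_0 - 1).
    by rewrite (le_trans _ (modulusB _ _))// opprB addrC subrK.
  by rewrite modulus1; lra.
have r1 : 1 - 3 * k <= (1 - k) / (1 + k) ^+ 2.
  rewrite ler_pdivlMr ?exprn_gt0 ?addr_gt0// -subr_ge0.
  have -> : 1 - k - (1 - 3 * k) * (1 + k) ^+ 2 = k ^+ 2 * (5 + 3 * k) by ring.
  by rewrite mulr_ge0 ?sqr_ge0// addr_ge0// mulr_ge0// ltW.
apply: (@le_trans _ _ (\sum_i \sum_(m < M) md ((g i) - (i == j)%:R%:P)`_m ^+ 2)).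
  rewrite (bigD1 i)//= -[X in X <= _]addr0 lerD//; last first.
    by apply: sumr_ge0 => i' _; apply: sumr_ge0 => m _; exact: sqr_ge0.
  have nM : (n <= M)%N by apply: leqW; exact: leq_addr.
  rewrite -!(big_mkord xpredT (fun m => md ((g i) - (i == j)%:R%:P)`_m ^+ 2)).
  rewrite (big_cat_nat (n := n) (p := M))//=.
  by rewrite lerDl sumr_ge0// => m _; exact: sqr_ge0.
(* [(1 + k)^2 + 1 - 2 (1 - 3 k) = 8 k + k^2 <= 9 k <= e^2], which is the origin of the constant
   9. *)
rewrite key; nra.
Qed.
End Vector.
End Smirnov.

(** * Power series on the disk *)

Section PowerSeries.
Variable R : realType.
Local Notation C := R[i].
Local Notation md := (@modulus R).
Implicit Types (p q : {poly C}) (f g h : C -> C) (a b : nat -> C).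

(** Convergence is only asked pointwise; uniformity on smaller disks is recovered from coefficient
    bounds in [power_series_tail]. *)
Definition power_series f a := forall z, in_disk z -> forall e : R, 0 < e ->
  exists N0, forall N, (N0 <= N)%N ->
    md (f z - \sum_(n < N) z ^+ n * a n) <= e.

Definition H2le f (K : R) := exists2 a, power_series f a & l2_le a K.

Lemma power_series_ext f g a : (forall z, in_disk z -> f z = g z) ->
  power_series f a -> power_series g a.
Proof. by move=> fg h z z1 e e0; rewrite -fg//; exact: h. Qed.

Lemma H2le_ext f g K : (forall z, in_disk z -> f z = g z) -> H2le f K -> H2le g K.
Proof. by move=> fg [a ha h]; exists a => //; exact: power_series_ext ha. Qed.

Lemma H2le_le f K L : 0 <= K -> K <= L -> H2le f K -> H2le f L.
Proof. by move=> K0 KL [a ha h]; exists a => //; exact: l2_le_le h. Qed.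

Lemma power_seriesD f g a b : power_series f a -> power_series g b ->
  power_series (fun z => f z + g z) (fun n => a n + b n).
Proof.
move=> ha hb z z1 e e0; have e2 : 0 < e / 2 by rewrite divr_gt0.
have [N1 h1] := ha z z1 _ e2; have [N2 h2] := hb z z1 _ e2.
exists (maxn N1 N2) => N; rewrite geq_max => /andP[N1N N2N].
under eq_bigr do rewrite mulrDr.
rewrite big_split /= opprD addrACA [e]splitr.
by apply: le_trans (modulusD _ _) _; rewrite lerD// ?h1// h2.
Qed.

Lemma power_seriesZ c f a : power_series f a ->
  power_series (fun z => c * f z) (fun n => c * a n).
Proof.
move=> ha z z1 e e0.
have c0 : 0 < md c + 1 by rewrite ltr_wpDl// modulus_ge0.
have [N0 h0] := ha z z1 _ (divr_gt0 e0 c0).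
exists N0 => N NN; under eq_bigr do rewrite mulrCA.
rewrite -mulr_sumr -mulrBr modulusM.
have := h0 N NN; rewrite ler_pdivlMr//; apply: le_trans.
by rewrite mulrC ler_wpM2l ?modulus_ge0// lerDl.
Qed.

Lemma power_seriesX f a : power_series f a ->
  power_series (fun z => z * f z) (fun n => if n is m.+1 then a m else 0).
Proof.
move=> ha z z1 e e0; have [N0 h0] := ha z z1 e e0.
exists N0.+1 => -[//|N]; rewrite ltnS => NN.
rewrite big_ord_recl mulr0 add0r; under eq_bigr do rewrite /= exprS -mulrA.
rewrite -mulr_sumr -mulrBr modulusM -[leRHS]mul1r; apply: ler_pM;
  rewrite ?modulus_ge0//; [exact: ltW|exact: h0].
Qed.

Lemma power_series_poly p : power_series (horner p) (fun n => p`_n).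
Proof.
move=> z z1 e e0; exists (size p) => N NN.
rewrite (horner_coef_wide _ NN).
under eq_bigr do rewrite mulrC.
by rewrite subrr modulus0 ltW.
Qed.

Definition poly_conv p a n : C := \sum_(i < n.+1) p`_i * a (n - i)%N.

Lemma power_series_eq f a b : a =1 b -> power_series f a -> power_series f b.
Proof.
move=> ab h z z1 e e0; have [N0 h0] := h z z1 e e0; exists N0 => N NN.
by under eq_bigr do rewrite -ab; exact: h0.
Qed.

(** Horner's scheme reduces the Cauchy product to a shift and a scalar multiple:
    [(p X + c) f = X (p f) + c f]. *)
Lemma power_seriesM p f a : power_series f a ->
  power_series (fun z => p.[z] * f z) (poly_conv p a).
Proof.
move=> ha; elim/poly_ind: p => [|p c IH].
  apply: power_series_ext (power_series_eq _ (power_seriesZ 0 ha)).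
    by move=> z _; rewrite horner0.
  by move=> n; rewrite mul0r /poly_conv big1// => i _; rewrite coef0 mul0r.
apply: power_series_ext (power_series_eq _ (power_seriesD (power_seriesX IH)
  (power_seriesZ c ha))).
  by move=> z _; rewrite hornerD hornerMX hornerC mulrDl; ring.
move=> [|n]; rewrite /poly_conv.
  by rewrite big_ord_recl big_ord0 coefD coefMX coefC /= !add0r addr0.
rewrite [in RHS]big_ord_recl coefD coefMX coefC /= add0r subn0 addrC.
congr (_ + _); apply: eq_bigr => i _.
by rewrite coefD coefMX coefC /= addr0.
Qed.

Lemma H2leD f g K L : 0 <= K -> 0 <= L -> H2le f K -> H2le g L ->
  H2le (fun z => f z + g z) (K + L).
Proof.
move=> K0 L0 [a ha hha] [b hb hhb]; exists (fun n => a n + b n).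
  exact: power_seriesD.
exact: l2_leD.
Qed.

Lemma l2_le0 : l2_le (fun=> 0 : C) 0.
Proof. by move=> n; rewrite big1 => [|i _]; rewrite ?modulus0 expr0n. Qed.

Lemma H2le0 : H2le (fun=> 0) 0.
Proof.
exists (fun=> 0); last exact: l2_le0.
move=> z z1 e e0; exists 0%N => N _.
by rewrite big1 ?subr0 ?modulus0 ?ltW// => i _; rewrite mulr0.
Qed.

Lemma H2leM p f S K : 0 <= K -> (forall z, md z = 1 -> md p.[z] <= S) ->
  H2le f K -> H2le (fun z => p.[z] * f z) (S * K).
Proof.
move=> K0 hp [a ha hha]; exists (poly_conv p a); first exact: power_seriesM.
exact: l2_le_mulp.
Qed.

Lemma H2le_sum (I : Type) (r : seq I) (f : I -> C -> C) (K : I -> R) :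
  (forall i, 0 <= K i) -> (forall i, H2le (f i) (K i)) ->
  H2le (fun z => \sum_(i <- r) f i z) (\sum_(i <- r) K i).
Proof.
move=> K0 h; elim: r => [|i r IH].
  by rewrite big_nil; apply: H2le_ext H2le0 => z _; rewrite big_nil.
rewrite big_cons; apply: H2le_ext (H2leD (K0 i) _ (h i) IH).
  by move=> z _; rewrite big_cons.
by apply: sumr_ge0 => l _; exact: K0.
Qed.

Section Tail.
Variables (a : nat -> C) (K r : R) (z : C).
Hypotheses (K0 : 0 <= K) (haK : forall n, md (a n) <= K).
Hypotheses (r1 : r < 1) (zr : md z <= r).

Let r0 : 0 <= r. Proof. exact: le_trans (modulus_ge0 z) zr. Qed.

Lemma partial_sum_diff N k :
  md (\sum_(n < N + k) z ^+ n * a n - \sum_(n < N) z ^+ n * a n)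
    <= K * r ^+ N / (1 - r).
Proof.
(* The induction on [k] needs this sharper bound, the exact geometric sum. *)
apply: (@le_trans _ _ (K * (r ^+ N - r ^+ (N + k)) / (1 - r))); last first.
  rewrite ler_wpM2r ?invr_ge0 ?subr_ge0 ?(ltW r1)// ler_wpM2l//.
  by rewrite gerBl exprn_ge0.
elim: k => [|k IH]; first by rewrite addn0 !subrr modulus0 mulr0 mul0r.
rewrite addnS big_ord_recr /= addrAC.
apply: le_trans (modulusD _ _) _; apply: le_trans (lerD IH (_ : _ <= K * r ^+ (N + k))) _.
  rewrite modulusM mulrC modulusX; apply: ler_pM; rewrite ?modulus_ge0 ?exprn_ge0 ?modulus_ge0//.
  by apply: lerXn2r; rewrite ?nnegrE ?modulus_ge0.
rewrite le_eqVlt; apply/orP; left; apply/eqP; rewrite exprS.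
by field; rewrite subr_eq0 gt_eqF.
Qed.

Lemma partial_sum_le N : md (\sum_(n < N) z ^+ n * a n) <= K / (1 - r).
Proof.
by have := partial_sum_diff 0 N; rewrite add0n big_ord0 subr0 expr0 mulr1.
Qed.

Lemma power_series_tail f N : power_series f a ->
  md (f z - \sum_(n < N) z ^+ n * a n) <= K * r ^+ N / (1 - r).
Proof.
move=> ha; apply/ler_addgt0Pr => e e0.
have z1 : in_disk z by exact: le_lt_trans zr r1.
have [N0 h0] := ha z z1 e e0.
have := h0 (N + N0)%N (leq_addl _ _).
have := partial_sum_diff N N0 => h1 h2.
rewrite [leRHS]addrC; apply: le_trans (lerD h2 h1).
by rewrite (le_trans _ (modulusD _ _))// addrA subrK.
Qed.

Lemma power_series_le f : power_series f a -> md (f z) <= K / (1 - r).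
Proof.
by move=> /(power_series_tail 0); rewrite big_ord0 subr0 expr0 mulr1.
Qed.

End Tail.
End PowerSeries.

(** * Products of square-summable power series *)

Section GridL1.
Variable R : realType.
Local Notation C := R[i].
Local Notation md := (@modulus R).
Implicit Types (p q : {poly C}) (f g h : C -> C) (a b : nat -> C).

Lemma grid_dilation N (w e : C) (r : R) p K : N.-primitive_root w ->
  md e = 1 -> 0 <= r -> r <= 1 -> (size p <= N)%N -> l2_le (fun n => p`_n) K ->
  \sum_(i < N) md p.[r%:C%C * (e * w ^+ i)] ^+ 2 <= N%:R * K ^+ 2.
Proof.
move=> hw e1 r0 r1 sp hp.
pose q := \poly_(n < N) (p`_n * r%:C%C ^+ n).
rewrite (eq_bigr (fun i : 'I_N => md q.[e * w ^+ i] ^+ 2)); last first.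
  move=> i _; rewrite (horner_coef_wide _ sp) horner_poly; congr (md _ ^+ 2).
  by apply: eq_bigr => n _; rewrite exprMn mulrA.
apply: (grid_hle hw e1); first exact: size_poly.
apply: l2_le_trunc; apply: l2_le_dom hp => n.
rewrite modulusM modulusX modulus_real// -[leRHS]mulr1 ler_wpM2l ?modulus_ge0//.
exact: exprn_ile1.
Qed.

Lemma grid_CS N (F G : 'I_N -> R) (K L : R) : 0 <= K -> 0 <= L ->
  \sum_i F i ^+ 2 <= N%:R * K ^+ 2 -> \sum_i G i ^+ 2 <= N%:R * L ^+ 2 ->
  \sum_i F i * G i <= N%:R * (K * L).
Proof.
move=> K0 L0 hF hG; have N0 : 0 <= N%:R :> R by [].
have -> : N%:R * (K * L) = Num.sqrt N%:R * K * (Num.sqrt N%:R * L).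
  by rewrite mulrACA -expr2 sqr_sqrtr.
apply: CauchySchwarz_sum; rewrite ?mulr_ge0 ?sqrtr_ge0//.
  by rewrite exprMn sqr_sqrtr.
by rewrite exprMn sqr_sqrtr.
Qed.

Lemma grid_mean N (F : 'I_N -> R) (K : R) : 0 <= K ->
  \sum_i F i ^+ 2 <= N%:R * K ^+ 2 -> \sum_i F i <= N%:R * K.
Proof.
move=> K0 hF; rewrite -[K]mulr1.
rewrite (eq_bigr (fun i => F i * 1)); last by move=> i _; rewrite mulr1.
apply: grid_CS => //.
by rewrite sumr_const card_ord expr1n mulr1.
Qed.

(** [L] is a Lipschitz constant along radii, by [1 - (1 - s)^n <= n s]. *)
Lemma poly_radius p (k : R) : 0 < k -> exists r : R, [/\ 0 < r, r < 1 &
  forall z, md z = 1 -> md (p.[z] - p.[r%:C%C * z]) <= k].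
Proof.
move=> k0; pose L := \sum_(n < size p) md p`_n * n%:R.
have L0 : 0 <= L by apply: sumr_ge0 => n _; rewrite mulr_ge0// modulus_ge0.
pose s := Num.min (1 / 2) (k / (L + 1)).
have s0 : 0 < s by rewrite lt_min !divr_gt0// ltr_wpDl.
have s1 : s <= 1 / 2 by rewrite ge_min lexx.
have sk : s * (L + 1) <= k.
  by rewrite -ler_pdivlMr ?ltr_wpDl// ge_min lexx orbT.
exists (1 - s); split; [lra|lra|move=> z z1].
rewrite !horner_coef -sumrB.
apply: le_trans (modulus_sum _ _ _) _.
apply: (@le_trans _ _ (\sum_(n < size p) s * (md p`_n * n%:R))); last first.
  by rewrite -mulr_sumr -/L; apply: le_trans sk; rewrite ler_wpM2l ?(ltW s0)// lerDl.
apply: ler_sum => n _.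
rewrite exprMn -mulrBr modulusM mulrCA ler_wpM2l ?modulus_ge0//.
rewrite -[X in X - _]mul1r -mulrBl modulusM modulusX z1 expr1n mulr1.
have h m : 1 - (1 - s) ^+ m <= s * m%:R /\ 0 <= 1 - (1 - s) ^+ m.
  elim: m => [|m [IH IH']]; first by rewrite expr0 subrr mulr0.
  rewrite exprS -natr1; have : 0 <= (1 - s) ^+ m by apply: exprn_ge0; lra.
  set y := _ ^+ m in IH IH' *; move=> y0; split; nra.
have -> : 1 - (1 - s)%:C%C ^+ n = (1 - (1 - s) ^+ n)%:C%C.
  by rewrite [RHS]rmorphB rmorph1 rmorphXn.
by rewrite modulus_real; case: (h n).
Qed.

(* The product [\sum_l f l * g l] need not be approximated in [L^1] by partial
   sums of its own series; comparing on circles of radius [r < 1], where all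
   series converge uniformly, and letting [r] tend to 1 avoids the issue. *)
Lemma grid_L1 d (f g : 'I_d -> C -> C) (a b : 'I_d -> nat -> C) (h : C -> C)
    (c : C) (p q : 'I_d -> {poly C}) (KA KB KP e d1 d2 k : R) :
  0 <= KA -> 0 <= KB -> 0 <= KP -> 0 <= e -> 0 <= d1 -> 0 <= d2 -> 0 < k ->
  (forall l, power_series (f l) (a l)) -> (forall l, l2_le (a l) KA) ->
  (forall l, power_series (g l) (b l)) -> (forall l, l2_le (b l) KB) ->
  H2le h e ->
  (forall z, in_disk z -> \sum_l f l z * g l z = c + h z) ->
  (forall l, l2_le (fun n => a l n - (p l)`_n) d1) ->
  (forall l, l2_le (fun n => b l n - (q l)`_n) d2) ->
  (forall l, l2_le (fun n => (p l)`_n) KP) ->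
  exists N0, forall N (w z : C), (N0 <= N)%N -> N.-primitive_root w ->
    md z = 1 ->
    \sum_(i < N) md (\sum_l (p l).[z * w ^+ i] * (q l).[z * w ^+ i] - c) <=
    N%:R * (e + d%:R * (d1 * KB + KP * d2) + k).
Proof.
move=> KA0 KB0 KP0 e0 d10 d20 k0 haf hKA hbg hKB [y hy hye] hsum hd1 hd2 hKP.
pose F := \sum_l p l * q l - c%:P.
have k2 : 0 < k / 2 by rewrite divr_gt0.
have [r [r0 r1 hr]] := poly_radius F k2.
have [r0' r1'] := (ltW r0, ltW r1).
have r10 : 0 < 1 - r by rewrite subr_gt0.
(* [B r^D] bounds all errors made on the circle of radius [r] by cutting the series at degree [D].
   Since [r] depends only on [F] and [k], [D] can be chosen after it. *)
pose B := d%:R * (2 * (KA / (1 - r)) * (KB / (1 - r))) + e / (1 - r).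
have KAr : 0 <= KA / (1 - r) by rewrite divr_ge0// ltW.
have KBr : 0 <= KB / (1 - r) by rewrite divr_ge0// ltW.
have B0 : 0 <= B by rewrite addr_ge0 ?mulr_ge0 ?invr_ge0// ltW.
have B1 : 0 < B + 1 by rewrite ltr_wpDl.
have [D0 hD0] := expr_le_small r0' r1 (divr_gt0 k2 B1).
pose D := (D0 + \max_l size (p l) + \max_l size (q l))%N.
have pD l : (size (p l) <= D)%N.
  rewrite /D addnAC; apply: leq_trans (leq_addl _ _).
  exact: (@leq_bigmax _ (fun l => size (p l))).
have qD l : (size (q l) <= D)%N.
  apply: leq_trans (leq_addl _ _).
  exact: (@leq_bigmax _ (fun l => size (q l))).
have hD : r ^+ D * B <= k / 2.
  have := hD0 D; rewrite /D -addnA leq_addr => /(_ isT).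
  rewrite ler_pdivlMr// => h'; apply: le_trans h'.
  by rewrite ler_wpM2l ?exprn_ge0// lerDl.
exists D => N w z DN hw z1.
pose aD l := \poly_(n < D) a l n; pose bD l := \poly_(n < D) b l n.
pose yD := \poly_(n < D) y n.
have horD (s : nat -> C) t : (\poly_(n < D) s n).[t] = \sum_(n < D) t ^+ n * s n.
  by rewrite horner_poly; apply: eq_bigr => n _; rewrite mulrC.
have sN (s : nat -> C) : (size (\poly_(n < D) s n) <= N)%N.
  exact: leq_trans (size_poly _ _) DN.
have ppt l : l2_le (fun n => (p l - aD l)`_n) d1.
  have h' : l2_le (fun n => (p l)`_n - a l n) d1.
    by apply: l2_le_dom (hd1 l) => n; rewrite modulusBC.
  apply: l2_le_ext (l2_le_trunc D h') => n; rewrite coefB !coef_poly.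
  by case: ltnP => // Dn; rewrite nth_default ?subrr// (leq_trans (pD l)).
have qqt l : l2_le (fun n => (q l - bD l)`_n) d2.
  have h' : l2_le (fun n => (q l)`_n - b l n) d2.
    by apply: l2_le_dom (hd2 l) => n; rewrite modulusBC.
  apply: l2_le_ext (l2_le_trunc D h') => n; rewrite coefB !coef_poly.
  by case: ltnP => // Dn; rewrite nth_default ?subrr// (leq_trans (qD l)).
have pt t : md t = 1 -> md F.[t] <=
    \sum_l (md (p l - aD l).[r%:C%C * t] * md (bD l).[r%:C%C * t] +
      md (p l).[r%:C%C * t] * md (q l - bD l).[r%:C%C * t]) +
    md yD.[r%:C%C * t] + k.
  move=> t1; set u := r%:C%C * t.
  have ur : md u <= r by rewrite modulusM t1 mulr1 modulus_real.
  have u1 : in_disk u by exact: le_lt_trans ur r1.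
  have ea l : md (f l u - (aD l).[u]) <= KA * r ^+ D / (1 - r).
    by rewrite horD; apply: power_series_tail => // n; exact: l2_le_coef.
  have eb l : md (g l u - (bD l).[u]) <= KB * r ^+ D / (1 - r).
    by rewrite horD; apply: power_series_tail => // n; exact: l2_le_coef.
  have ey : md (h u - yD.[u]) <= e * r ^+ D / (1 - r).
    by rewrite horD; apply: power_series_tail => // n; exact: l2_le_coef.
  have fa l : md (f l u) <= KA / (1 - r).
    by apply: power_series_le (haf l) => // n; exact: l2_le_coef.
  have gb l : md (bD l).[u] <= KB / (1 - r).
    by rewrite horD; apply: partial_sum_le => // n; exact: l2_le_coef.
  (* [p q - aD bD = (p - aD) bD + p (q - bD)] and [f g - aD bD = (f - aD) bD + f (g - bD)], with
     [\sum f g = c + h]. Differences from the polynomials are measured in mean over the grid,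
     differences from the series uniformly at radius [r]. *)
  have -> : F.[t] = F.[t] - F.[u] + ((\sum_l (((p l - aD l).[u] * (bD l).[u] +
      (p l).[u] * (q l - bD l).[u]) -
     ((f l u - (aD l).[u]) * (bD l).[u] + f l u * (g l u - (bD l).[u])))) +
      (yD.[u] + (h u - yD.[u]))).
    have -> : F.[u] = \sum_l (p l).[u] * (q l).[u] - c.
      rewrite hornerD hornerN hornerC horner_sum; congr (_ - _).
      by apply: eq_bigr => l _; rewrite hornerM.
    have -> : h u = \sum_l f l u * g l u - c by rewrite hsum// addrC addKr.
    rewrite [X in _ = _ + X](_ : _ = \sum_l (p l).[u] * (q l).[u] - c) ?subrK//.
    rewrite [yD.[u] + _]addrC subrK addrA -big_split /=; congr (_ - _).
    by apply: eq_bigr => l _; rewrite !hornerD !hornerN; ring.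
  apply: le_trans (modulusD _ _) _; rewrite [leRHS]addrC.
  have {}hr := hr _ t1.
  rewrite [k]splitr -addrA; apply: lerD => //.
  apply: le_trans (modulusD _ _) _.
  apply: (@le_trans _ _ (\sum_l (md (p l - aD l).[u] * md (bD l).[u] +
      md (p l).[u] * md (q l - bD l).[u]) +
      \sum_(l < d) (r ^+ D * (2 * (KA / (1 - r)) * (KB / (1 - r)))) +
      (md yD.[u] + r ^+ D * (e / (1 - r))))).
    apply: lerD; last first.
      apply: le_trans (modulusD _ _) _; rewrite lerD2l.
      by rewrite mulrA [r ^+ D * _]mulrC.
    rewrite -big_split /=; apply: le_trans (modulus_sum _ _ _) _.
    apply: ler_sum => l _; apply: le_trans (modulusB _ _) _; apply: lerD.
      by rewrite -!modulusM modulusD.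
    apply: le_trans (modulusD _ _) _; rewrite !modulusM.
    have -> : r ^+ D * (2 * (KA / (1 - r)) * (KB / (1 - r))) =
      KA * r ^+ D / (1 - r) * (KB / (1 - r)) +
      KA / (1 - r) * (KB * r ^+ D / (1 - r)) by ring.
    by apply: lerD; apply: ler_pM; rewrite ?modulus_ge0.
  rewrite sumr_const card_ord -[X in _ + X + _]mulr_natl mulrCA.
  move: hD; rewrite /B mulrDr; lra.
apply: (@le_trans _ _ (\sum_(i < N) ((\sum_l
   (md (p l - aD l).[r%:C%C * (z * w ^+ i)] * md (bD l).[r%:C%C * (z * w ^+ i)] +
    md (p l).[r%:C%C * (z * w ^+ i)] * md (q l - bD l).[r%:C%C * (z * w ^+ i)])) +
    md yD.[r%:C%C * (z * w ^+ i)] + k))).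
  apply: ler_sum => i _; apply: le_trans (pt _ (grid_mod hw i z1)).
  rewrite le_eqVlt; apply/orP; left; apply/eqP; congr md.
  rewrite hornerD hornerN hornerC horner_sum; congr (_ - _).
  by apply: eq_bigr => l _; rewrite hornerM.
rewrite !big_split /= sumr_const card_ord -[k *+ N]mulr_natl.
rewrite [N%:R * (_ + k)]mulrDr [N%:R * (e + _)]mulrDr.
rewrite lerD2r addrC; apply: lerD.
  by apply: grid_mean => //; apply: grid_dilation => //;
    [exact: sN|exact: l2_le_trunc].
rewrite exchange_big /= mulrCA mulr_natl -[X in _ *+ X](card_ord d) -sumr_const.
apply: ler_sum => l _; rewrite big_split mulrDr; apply: lerD; apply: grid_CS => //;
  apply: grid_dilation => //.
- rewrite (leq_trans (size_polyD _ _))// size_polyN geq_max sN.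
  by rewrite (leq_trans (pD l)).
- exact: sN.
- exact: l2_le_trunc.
- exact: leq_trans (pD l) DN.
- rewrite (leq_trans (size_polyD _ _))// size_polyN geq_max sN.
  by rewrite (leq_trans (qD l)).
Qed.

End GridL1.

(** * Geometric means and determinants *)

Section GeometricMean.
Variable R : realType.

(** The inequality between arithmetic and geometric means, the only passage from sums over a grid to
    products. *)
Lemma prod1D_le (N : nat) (x : 'I_N -> R) (m : R) : 0 <= m ->
  (forall i, 0 <= x i) -> \sum_i x i <= N%:R * m ->
  \prod_i (1 + x i) <= (1 + m) ^+ N.
Proof.
move=> m0 x0 hx; case: N x x0 hx => [|N] x x0 hx; first by rewrite big_ord0 expr0.
have x1 i : 0 <= 1 + x i by rewrite addr_ge0.
apply: (@le_trans _ _ ((\sum_i (1 + x i) / N.+1%:R) ^+ N.+1)).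
  have [+ _] := @leif_AGM R 'I_N.+1 predT (fun i => 1 + x i) (fun i _ => x1 i).
  by rewrite mulr_suml card_ord.
apply: lerXn2r; rewrite ?nnegrE ?addr_ge0//.
  by apply: sumr_ge0 => i _; rewrite divr_ge0.
rewrite -mulr_suml ler_pdivrMr ?ltr0n// big_split /= sumr_const card_ord.
by rewrite mulrDl mul1r lerD2l mulrC.
Qed.

Lemma expr1D_le (x : R) n : 0 <= x -> x <= 1 -> (1 + x) ^+ n <= 1 + 3 ^+ n * x.
Proof.
move=> x0 x1; elim: n => [|n IH]; first by rewrite !expr0; lra.
rewrite !exprS; apply: (@le_trans _ _ ((1 + x) * (1 + 3 ^+ n * x))).
  by rewrite ler_wpM2l// addr_ge0.
have : 1 <= 3 ^+ n :> R by rewrite exprn_ege1// ler1n.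
set T := 3 ^+ n => T1.
have h1 : 0 <= (T - 1) * x by rewrite mulr_ge0// subr_ge0.
have h2 : 0 <= T * (x * (1 - x)).
  by rewrite !mulr_ge0 ?subr_ge0// (le_trans ler01).
lra.
Qed.

(** [t b^n] has no controlled mean when [b] is only bounded in mean. The factorization [1 + c t b^n
    <= (1 + c l^-n t) (1 + l b)^n] separates the two. A small [l] brings the mean of the second
    factor near 1, then [s], depending on [l], does the same for the first. *)
Lemma geometric_mean_small n (c B k : R) : 0 <= c -> 0 <= B -> 0 < k -> k <= 1 ->
  exists2 s : R, 0 < s & forall N (t b : 'I_N -> R),
    (forall i, 0 <= t i) -> (forall i, 0 <= b i) ->
    \sum_i t i <= N%:R * s -> \sum_i b i <= N%:R * B ->
    \prod_i (1 + c * t i * b i ^+ n) <= (1 + k) ^+ N.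
Proof.
move=> c0 B0 k0 k1.
have B1 : 0 < B + 1 by rewrite ltr_wpDl.
have n3 : 1 <= 3 ^+ n :> R by rewrite exprn_ege1// ler1n.
have n30 : 0 < 3 ^+ n :> R by apply: lt_le_trans n3.
(* [3 ^+ n] compensates the loss in [expr1D_le]; [B + 1] avoids a division by 0. *)
pose l := k / 3 / 3 ^+ n / (B + 1).
have l0 : 0 < l by rewrite !divr_gt0.
have lB0 : 0 <= l * B by rewrite mulr_ge0// ltW.
have lB : l * B * 3 ^+ n <= k / 3.
  have -> : k / 3 = l * (B + 1) * 3 ^+ n by rewrite /l; field; rewrite !gt_eqF.
  by rewrite ler_wpM2r ?(ltW n30)// ler_wpM2l ?(ltW l0)// lerDl.
have hlB : (1 + l * B) ^+ n <= 1 + k / 3.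
  apply: le_trans (expr1D_le n lB0 _) _; last by rewrite lerD2l mulrC.
  have : l * B <= l * B * 3 ^+ n by rewrite ler_peMr.
  by lra.
have c1 : 0 < c + 1 by rewrite ltr_wpDl.
have ln0 : 0 < l ^+ n by rewrite exprn_gt0.
pose s := k / 3 * l ^+ n / (c + 1).
have s0 : 0 < s by rewrite !divr_gt0// mulr_gt0// divr_gt0.
have cs : c / l ^+ n * s <= k / 3.
  have -> : c / l ^+ n * s = k / 3 * (c / (c + 1)).
    by rewrite /s; field; rewrite !gt_eqF.
  rewrite ler_piMr ?divr_ge0 ?(ltW k0)// ler_pdivrMr// mul1r lerDl.
  by [].
exists s => // N t b t0 b0 ht hb.
have cl0 : 0 <= c / l ^+ n by rewrite divr_ge0// ltW.
have h1 i : 0 <= c / l ^+ n * t i by rewrite mulr_ge0.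
have h2 i : 0 <= l * b i by rewrite mulr_ge0// ltW.
have hb1 i : 0 <= 1 + l * b i by rewrite addr_ge0.
apply: (@le_trans _ _ (\prod_i ((1 + c / l ^+ n * t i) * (1 + l * b i) ^+ n))).
  apply: ler_prod => i _; rewrite addr_ge0 ?mulr_ge0 ?exprn_ge0//=.
  rewrite mulrDl mul1r; apply: lerD.
    by rewrite exprn_ege1// lerDl.
  have -> : c * t i * b i ^+ n = c / l ^+ n * t i * (l * b i) ^+ n.
    rewrite (exprMn _ l (b i)); have := gt_eqF ln0; set L := l ^+ n => /negbT L0.
    by field.
  by rewrite ler_wpM2l// lerXn2r// ?nnegrE// lerDr.
rewrite big_split /= prodrXl.
have k30 : 0 <= k / 3 by rewrite divr_ge0// ltW.
have cls0 : 0 <= c / l ^+ n * s by rewrite mulr_ge0// ltW.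
have hk : (1 + k / 3) ^+ 2 <= 1 + k by nra.
apply: (@le_trans _ _ (((1 + k / 3) ^+ 2) ^+ N)); last first.
  apply: lerXn2r => //; rewrite ?nnegrE; first by rewrite exprn_ge0// addr_ge0.
  by rewrite addr_ge0// ltW.
rewrite -exprM mulnC exprM expr2; apply: ler_pM.
- by apply: prodr_ge0 => i _; rewrite addr_ge0.
- by rewrite exprn_ge0// prodr_ge0.
- apply: (@le_trans _ _ ((1 + c / l ^+ n * s) ^+ N)).
    apply: prod1D_le => //.
    by rewrite -mulr_sumr mulrCA ler_wpM2l.
  by apply: lerXn2r; rewrite ?nnegrE ?lerD2l// addr_ge0.
apply: (@le_trans _ _ (((1 + l * B) ^+ n) ^+ N)).
  rewrite -exprM mulnC exprM; apply: lerXn2r; rewrite ?nnegrE.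
  - by rewrite prodr_ge0.
  - by rewrite exprn_ge0// addr_ge0.
  apply: prod1D_le => //.
  by rewrite -mulr_sumr mulrCA ler_wpM2l// ltW.
apply: lerXn2r => //; rewrite ?nnegrE; last exact: addr_ge0.
by rewrite exprn_ge0// addr_ge0.
Qed.

End GeometricMean.

(** * Determinants and adjugates of nearly inverse matrices *)

Section MatrixBounds.
Variable R : realType.
Local Notation C := R[i].
Local Notation md := (@modulus R).

(** The entrywise l^1 norm: submultiplicative, and a plain sum of moduli, so its mean over a grid
    follows from the means of the entries. *)
Definition mxsum m n (X : 'M[C]_(m, n)) : R := \sum_i \sum_j md (X i j).

Lemma mxsum_ge0 m n (X : 'M[C]_(m, n)) : 0 <= mxsum X.
Proof. by do 2!(apply: sumr_ge0 => ? _); exact: modulus_ge0. Qed.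

Lemma mxsum_entry m n (X : 'M[C]_(m, n)) i j : md (X i j) <= mxsum X.
Proof.
rewrite /mxsum (bigD1 i)//= (bigD1 j)//= -addrA lerDl addr_ge0//.
  by apply: sumr_ge0 => ? _; exact: modulus_ge0.
by do 2!(apply: sumr_ge0 => ? _); exact: modulus_ge0.
Qed.

Lemma mxsumM m n p (X : 'M[C]_(m, n)) (Y : 'M[C]_(n, p)) :
  mxsum (X *m Y) <= mxsum X * mxsum Y.
Proof.
rewrite /mxsum mulr_suml; apply: ler_sum => i _.
apply: (@le_trans _ _ (\sum_j \sum_k md (X i k) * md (Y k j))).
  apply: ler_sum => j _; rewrite mxE; apply: le_trans (modulus_sum _ _ _) _.
  by apply: ler_sum => k _; rewrite modulusM.
rewrite exchange_big /= mulr_suml; apply: ler_sum => k _.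
rewrite -mulr_sumr ler_wpM2l ?modulus_ge0//.
rewrite [leRHS](bigD1 k)//= lerDl.
by do 2!(apply: sumr_ge0 => ? _); exact: modulus_ge0.
Qed.

Lemma modulus_sign (n : nat) : md ((-1) ^+ n) = 1.
Proof. by rewrite modulusX modulusN modulus1 expr1n. Qed.

Lemma det_le n (X : 'M[C]_n) (b : R) : (forall i j, md (X i j) <= b) ->
  md (\det X) <= n`!%:R * b ^+ n.
Proof.
move=> h; apply: le_trans (modulus_sum _ _ _) _.
rewrite mulr_natl -[X in _ *+ X](card_Sn n) -sumr_const.
apply: ler_sum => s _; rewrite modulusM modulus_sign mul1r modulus_prod.
rewrite -[X in b ^+ X](card_ord n) -prodr_const; apply: ler_prod => i _.
by rewrite modulus_ge0 h.
Qed.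

(** Cofactors are determinants of order [d - 1]; as the base [1 + mxsum X] is at least 1, exponent
    and factorial are rounded up to [d]. *)
Lemma mxsum_adj d (X : 'M[C]_d) :
  mxsum (\adj X) <= (d * d * d`!)%:R * (1 + mxsum X) ^+ d.
Proof.
have b1 : 1 <= 1 + mxsum X by rewrite lerDl mxsum_ge0.
apply: (@le_trans _ _ (\sum_(i < d) \sum_(j < d) d`!%:R * (1 + mxsum X) ^+ d)).
  apply: ler_sum => i _; apply: ler_sum => j _.
  rewrite mxE modulusM modulus_sign mul1r.
  have h k l : md (row' j (col' i X) k l) <= 1 + mxsum X.
    by rewrite !mxE (le_trans (mxsum_entry _ _ _))// lerDr.
  apply: le_trans (det_le h) _.
  case: d X i j b1 {h} => [|d] X i j b1; first by case: i.
  have b0 : 0 <= 1 + mxsum X by apply: le_trans b1.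
  apply: ler_pM; rewrite ?exprn_ge0//; last by rewrite ler_weXn2l.
  by rewrite ler_nat factS leq_pmull.
by rewrite !sumr_const !card_ord -mulrnA -[leLHS]mulr_natl mulrA -natrM.
Qed.

(** The factors are exchanged one at a time: the exchanged one contributes [s], the others at most
    [1 + s] or 1. *)
Lemma prod_perturb d (x y : 'I_d -> C) (s : R) : 0 <= s ->
  (forall i, md (y i) <= 1) -> (forall i, md (x i - y i) <= s) ->
  md (\prod_i x i - \prod_i y i) <= d%:R * s * (1 + s) ^+ d.
Proof.
move=> s0; elim: d x y => [|d IH] x y hy hxy.
  by rewrite !big_ord0 subrr modulus0 !mul0r.
rewrite !big_ord_recl; set X := \prod_(_ < d) _; set Y := \prod_(i < d) y _.
have h : md (X - Y) <= d%:R * s * (1 + s) ^+ d by exact: IH.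
have hX : md X <= (1 + s) ^+ d.
  rewrite /X modulus_prod -[X in _ ^+ X](card_ord d) -prodr_const.
  apply: ler_prod => i _; rewrite modulus_ge0 /=.
  rewrite -[x _](subrK (y (lift ord0 i))) addrC.
  by rewrite (le_trans (modulusD _ _))// lerD.
have -> : x ord0 * X - y ord0 * Y = (x ord0 - y ord0) * X + y ord0 * (X - Y).
  by ring.
apply: le_trans (modulusD _ _) _; rewrite !modulusM.
have s1 : 0 <= (1 + s) ^+ d by rewrite exprn_ge0// addr_ge0.
apply: (@le_trans _ _ (s * (1 + s) ^+ d + 1 * (d%:R * s * (1 + s) ^+ d))).
  by apply: lerD; apply: ler_pM; rewrite ?modulus_ge0.
rewrite exprS -natr1 mul1r; have : 0 <= d%:R * s * (1 + s) ^+ d by rewrite !mulr_ge0.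
have : 0 <= s * (1 + s) ^+ d by rewrite mulr_ge0.
set p := (1 + s) ^+ d in s1 *; set D := d%:R; nra.
Qed.

Lemma det_perturb d (E : 'M[C]_d) :
  md (\det (1%:M + E) - 1) <= (d`! * d)%:R * mxsum E * (1 + mxsum E) ^+ d.
Proof.
rewrite -{2}(det1 _ d) -sumrB; apply: le_trans (modulus_sum _ _ _) _.
rewrite natrM -!mulrA mulr_natl -[X in _ *+ X](card_Sn d) -sumr_const.
apply: ler_sum => s _; rewrite -mulrBr modulusM modulus_sign mul1r mulrA.
apply: prod_perturb => [|i|i]; first exact: mxsum_ge0.
  by rewrite mxE; case: eqP => _; rewrite ?modulus1 ?modulus0.
by rewrite [X in md (X - _)]mxE [X in md X]addrC addKr mxsum_entry.
Qed.

(* An approximate left inverse [B] and an approximate right inverse [M] of [A]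
   make [M] an approximate left inverse up to determinants. *)
Lemma mul_det_approx d (A B M E1 E : 'M[C]_d) : B *m A = 1%:M + E1 ->
  A *m M = 1%:M + E ->
  (\det A * \det B) *: (M *m A) =
  (\det (1%:M + E1))%:M + \det B *: (\adj A *m E *m A).
Proof.
move=> h1 h2; rewrite -h1 det_mulmx.
have -> : E = A *m M - 1%:M by rewrite h2 addrC addKr.
rewrite mulmxBr mulmx1 mulmxBl mulmxA mul_adj_mx mul_scalar_mx -scalemxAl.
by rewrite scalerBr scalerA scale_scalar_mx addrC subrK mulrC.
Qed.

(** The determinant perturbation gives [x1], the remainder with the adjugate gives [x2], and
    [1 + x1 + x2 <= (1 + x1) (1 + x2)]. The product form lets the geometric means of the two errors
    be estimated separately. *)
Lemma det_approx_deviation d (A B M : 'M[C]_d) (j : 'I_d) (b : R) : md (\det B) <= b ->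
  1 + \sum_i md (((\det A * \det B) *: (M *m A)) i j - (i == j)%:R) <=
  (1 + (d`! * d)%:R * mxsum (B *m A - 1%:M) * (1 + mxsum (B *m A - 1%:M)) ^+ d) *
  (1 + b * (d * d * d`!)%:R * mxsum (A *m M - 1%:M) * (1 + mxsum A) ^+ d.+1).
Proof.
move=> hb.
pose E1 := B *m A - 1%:M; pose E := A *m M - 1%:M.
have h1 : B *m A = 1%:M + E1 by rewrite /E1 addrC subrK.
have h2 : A *m M = 1%:M + E by rewrite /E addrC subrK.
rewrite (mul_det_approx h1 h2) -/E1 -/E.
have b0 : 0 <= b by apply: le_trans hb; exact: modulus_ge0.
set x1 := _ * _ * (1 + mxsum E1) ^+ d.
set x2 := _ * _ * (1 + mxsum A) ^+ d.+1.
have hx1 := det_perturb E1; rewrite -/x1 in hx1.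
have x10 : 0 <= x1 by apply: le_trans hx1; exact: modulus_ge0.
have hx2 : b * mxsum (\adj A *m E *m A) <= x2.
  rewrite /x2 -!mulrA ler_wpM2l//.
  apply: le_trans (mxsumM _ _) _; apply: le_trans (ler_wpM2r (mxsum_ge0 _) (mxsumM _ _)) _.
  apply: (@le_trans _ _ ((d * d * d`!)%:R * (1 + mxsum A) ^+ d * mxsum E * (1 + mxsum A))).
    apply: ler_pM; rewrite ?mulr_ge0 ?mxsum_ge0 ?lerDr//.
    by rewrite ler_wpM2r ?mxsum_ge0// mxsum_adj.
  by rewrite exprS -!mulrA ler_wpM2l// le_eqVlt; apply/orP; left; apply/eqP; ring.
have x20 : 0 <= x2 by apply: le_trans hx2; rewrite mulr_ge0// mxsum_ge0.
apply: (@le_trans _ _ (1 + (x1 + x2))); last by nra.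
rewrite lerD2l.
apply: (@le_trans _ _ (\sum_i (md ((\det (1%:M + E1) - 1) *+ (i == j)) +
   b * md ((\adj A *m E *m A) i j)))).
  apply: ler_sum => i _; rewrite !mxE addrAC -mulrnBl.
  apply: le_trans (modulusD _ _) _; rewrite lerD2l modulusM.
  by rewrite ler_wpM2r ?modulus_ge0.
rewrite big_split /=; apply: lerD.
  rewrite (bigD1 j)//= eqxx big1 ?addr0// => i /negbTE ->.
  exact: modulus0.
apply: le_trans hx2; rewrite -mulr_sumr ler_wpM2l//.
apply: ler_sum => i _; rewrite (bigD1 j)//= lerDl.
by apply: sumr_ge0 => ? _; exact: modulus_ge0.
Qed.

End MatrixBounds.

(** * Density of the unit vectors *)

Section Families.
Variable R : realType.
Local Notation C := R[i].
Local Notation md := (@modulus R).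

Lemma fin_eventually (I : finType) (P : I -> nat -> Prop) :
  (forall i, exists n0, forall n, (n0 <= n)%N -> P i n) ->
  exists n0, forall n, (n0 <= n)%N -> forall i, P i n.
Proof.
move=> /fin_all_exists[f hf]; exists (\max_i f i)%N => n hn i.
by apply: hf; apply: leq_trans hn; exact: leq_bigmax.
Qed.

Lemma fin_bound (I : finType) (P : I -> R -> Prop) :
  (forall i K L, 0 <= K -> K <= L -> P i K -> P i L) ->
  (forall i, exists2 K, 0 <= K & P i K) ->
  exists2 K, 0 <= K & forall i, P i K.
Proof.
move=> mono /fin_all_exists2[f f0 hf]; exists (\sum_i f i); first exact: sumr_ge0.
move=> i; apply: mono (hf i) => //.
by rewrite (bigD1 i)//= lerDl sumr_ge0.
Qed.

Lemma H2le_family (I : finType) (f : I -> C -> C) :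
  (forall i, exists2 K, 0 <= K & H2le (f i) K) ->
  exists K (a : I -> nat -> C), [/\ 0 <= K,
    forall i, power_series (f i) (a i) & forall i, l2_le (a i) K].
Proof.
move=> h; have [|K K0 /fin_all_exists2[a h1 h2]] :=
    @fin_bound I (fun i => H2le (f i)) _ h.
  by move=> i K L; exact: H2le_le.
by exists K, a.
Qed.

Lemma circle_bound (p : {poly C}) : exists2 K : R, 0 <= K &
  forall z, md z = 1 -> md p.[z] <= K.
Proof.
exists (\sum_(i < size p) md p`_i).
  by apply: sumr_ge0 => i _; exact: modulus_ge0.
move=> z z1; rewrite horner_coef; apply: le_trans (modulus_sum _ _ _) _.
by apply: ler_sum => i _; rewrite modulusM modulusX z1 expr1n mulr1.
Qed.

(** Otherwise every tail has mass at least [e^2], and enough disjoint blocks of that mass exceed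
    [K^2]. *)
Lemma l2_le_tail (a : nat -> C) (K e : R) : l2_le a K -> 0 < e ->
  exists s0, forall s, (s0 <= s)%N ->
    l2_le (fun n => a n - (\poly_(k < s) a k)`_n) e.
Proof.
move=> ha e0; apply: contrapT => H.
have step s : exists2 n, (s <= n)%N &
    e ^+ 2 <= \sum_(s <= i < n) md (a i) ^+ 2.
  apply: contrapT => h; apply: H; exists s => t st n.
  apply: (@le_trans _ _ (\sum_(s <= i < maxn n s) md (a i) ^+ 2)); last first.
    rewrite leNgt; apply/negP => /ltW h'; apply: h.
    by exists (maxn n s); rewrite ?leq_maxr.
  apply: (@le_trans _ _ (\sum_(i < maxn n s) md (a i - (\poly_(k < t) a k)`_i) ^+ 2)).
    rewrite -!(big_mkord xpredT (fun i => md (a i - (\poly_(k < t) a k)`_i) ^+ 2)).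
    rewrite [leRHS](big_cat_nat (n := n))//= ?leq_maxl//.
    by rewrite lerDl sumr_ge0// => i _; exact: sqr_ge0.
  rewrite -(big_mkord xpredT (fun i => md (a i - (\poly_(k < t) a k)`_i) ^+ 2)).
  rewrite (big_cat_nat (n := s))//= ?leq_maxr//.
  rewrite big_nat big1 ?add0r => [|i /andP[_ is_]]; last first.
    by rewrite coef_poly (leq_trans is_ st) subrr modulus0 expr0n.
  apply: ler_sum => i _; rewrite coef_poly; case: ifP => _.
    by rewrite subrr modulus0 expr0n sqr_ge0.
  by rewrite subr0.
have grow m : exists n, m%:R * e ^+ 2 <= \sum_(i < n) md (a i) ^+ 2.
  elim: m => [|m [n hn]]; first by exists 0%N; rewrite mul0r big_ord0.
  have [n' nn' h] := step n; exists n'.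
  rewrite -(big_mkord xpredT (fun i => md (a i) ^+ 2)) (big_cat_nat (n := n))//=.
  by rewrite -natr1 mulrDl mul1r big_mkord lerD.
have e2 : 0 < e ^+ 2 by rewrite exprn_gt0.
have [n] := grow (Num.bound (K ^+ 2 / e ^+ 2)).
apply/negP; rewrite -ltNge; apply: le_lt_trans (ha n) _.
by rewrite -ltr_pdivrMr//; apply: archi_boundP; rewrite divr_ge0// sqr_ge0.
Qed.

End Families.

Lemma mul_le_of_divD1 (R : realType) (D K x y : R) : 0 < D -> 0 <= K -> 0 <= x ->
  x <= y / D / (K + 1) -> D * (K * x) <= y.
Proof.
move=> D0 K0 x0; rewrite !ler_pdivlMr ?ltr_wpDl//; apply: le_trans.
by rewrite mulrC ler_wpM2r ?(ltW D0)// mulrC ler_wpM2l// lerDl.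
Qed.

Section Core.
Variables (R : realType) (d : nat).
Local Notation C := R[i].
Local Notation md := (@modulus R).
Variables (A : 'I_d -> 'I_d -> C -> C) (MM : ('I_d -> C -> C) -> Prop).

Hypothesis hA : forall i j, exists2 K, 0 <= K & H2le (A i j) K.
Hypothesis hMH : forall m, MM m -> forall i, exists2 K, 0 <= K & H2le (m i) K.
Hypothesis hMM : forall m : 'I_d -> 'I_d -> C -> C, (forall l, MM (m l)) ->
  forall c : 'I_d -> {poly C}, MM (fun i z => \sum_l m l i z * (c l).[z]).
Hypothesis hB : forall e : R, 0 < e -> exists B : 'I_d -> 'I_d -> {poly C},
  forall i j, H2le (fun z => \sum_l (B i l).[z] * A l j z - (i == j)%:R) e.
Hypothesis hM : forall e : R, 0 < e -> exists2 m : 'I_d -> 'I_d -> C -> C,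
  forall j, MM (m j) &
  forall i j, H2le (fun z => \sum_l A i l z * m j l z - (i == j)%:R) e.

(** The order of the choices matters. [B] is fixed before [m], because the smallness required of
    [A m - 1] depends on a bound for [det B]. [A] is truncated once both are known, which determines
    the polynomial column [c], and only then [m], because its truncation error gets multiplied by
    [c]. *)
Lemma dense_unit_vectors (e : R) (j : 'I_d) : 0 < e ->
  exists2 u, MM u & forall i, H2le (fun z => u i z - (i == j)%:R) e.
Proof.
move=> e0; have d0 : 0 < d%:R :> R by rewrite ltr0n (leq_ltn_trans _ (ltn_ord j)).
pose dd : R := d%:R * d%:R; have dd0 : 0 < dd by rewrite mulr_gt0.
have [KA [a [KA0 haA hKA]]] := @H2le_family R _ (fun ij : 'I_d * 'I_d => A ij.1 ij.2)
  (fun ij => hA ij.1 ij.2).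
(* So that [9 k <= (e / 2)^2]: one half of [e] is for the multiplier, the other for returning from
   the truncation [m'] to [m]. *)
pose k := Num.min 1 (e ^+ 2 / 36).
have k0 : 0 < k by rewrite lt_min ltr01 divr_gt0// exprn_gt0.
have k1 : k <= 1 by rewrite ge_min lexx.
have ke : 9 * k <= (e / 2) ^+ 2.
  have : k <= e ^+ 2 / 36 by rewrite ge_min lexx orbT.
  by rewrite expr_div_n -[2 ^+ 2]/(2 * 2); lra.
have k3 : 0 < k / 3 by rewrite divr_gt0.
have k31 : k / 3 <= 1 by lra.
have k310 : 0 <= 1 + k / 3 by lra.
have kk : (1 + k / 3) * (1 + k / 3) <= 1 + k by nra.
pose C1 : R := (d`! * d)%:R.
(* Here the factor bounded in mean is [1 + E1], with mean at most [1 + s1 <= 2]; hence the cap of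
   [s1] at 1. *)
have [s1' s1'0 hs1'] := geometric_mean_small d (ler0n R _ : 0 <= C1) (ler0n R 2) k3 k31.
pose s1 := Num.min 1 s1'.
have s10 : 0 < s1 by rewrite lt_min ltr01.
have s11 : s1 <= 1 by rewrite ge_min lexx.
have s1s : s1 <= s1' by rewrite ge_min lexx orbT.
(* [grid_L1] returns three errors of size at most [e1] for each of the [dd = d^2] entries; for [e2]
   below there are four. *)
pose e1 := s1 / dd / 3; have e10 : 0 < e1 by rewrite !divr_gt0.
have [B hBe] := hB e10.
have [KB KB0 hKB] : exists2 K, 0 <= K & forall ij : 'I_d * 'I_d,
    forall z, md z = 1 -> md (B ij.1 ij.2).[z] <= K.
  apply: fin_bound => [ij K L K0 KL h z z1|ij]; last exact: circle_bound.
  exact: le_trans (h z z1) KL.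
pose detB := \det (\matrix_(i, l) B i l).
have [SB SB0 hSB] := circle_bound detB.
pose C2 := SB * (d * d * d`!)%:R.
have C20 : 0 <= C2 by rewrite mulr_ge0.
pose BA := 1 + dd * KA.
have BA0 : 0 <= BA by rewrite addr_ge0// mulr_ge0// ltW.
have [s2 s20 hs2] := geometric_mean_small d.+1 C20 BA0 k3 k31.
pose e2 := s2 / dd / 4; have e20 : 0 < e2 by rewrite !divr_gt0.
have [m hmM hme] := hM e20.
have [Km [b [Km0 hbm hKm]]] := @H2le_family R _
  (fun ij : 'I_d * 'I_d => m ij.1 ij.2) (fun ij => hMH (hmM ij.1) ij.2).
pose del1 := Num.min (e1 / d%:R / (KB + 1)) (e2 / d%:R / (Km + 1)).
have KB1 : 0 < KB + 1 by rewrite ltr_wpDl.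
have Km1 : 0 < Km + 1 by rewrite ltr_wpDl.
have del10 : 0 < del1 by rewrite lt_min !divr_gt0.
have del1B : d%:R * (KB * del1) <= e1.
  by apply: mul_le_of_divD1; rewrite ?(ltW del10)// ge_min lexx.
have del1m : d%:R * (del1 * Km) <= e2.
  by rewrite [del1 * _]mulrC; apply: mul_le_of_divD1; rewrite ?(ltW del10)// ge_min lexx orbT.
have [sA /(_ _ (leqnn _)) hsA] := fin_eventually (fun ij => l2_le_tail (hKA ij) del10).
pose A' i l := \poly_(n < sA) a (i, l) n.
pose matA := \matrix_(i, l) A' i l.
(* The [j]-th column of the truncated [A] times [det A det B], so that [u] is the [j]-th column of
   [(det A det B) M A] with all matrices polynomial. *)
pose c l := A' l j * (\det matA * detB).
have [SC SC0 hSC] : exists2 K, 0 <= K & forall l z, md z = 1 -> md (c l).[z] <= K.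
  apply: fin_bound => [l K L K0 KL h z z1|l]; last exact: circle_bound.
  exact: le_trans (h z z1) KL.
have SC1 : 0 < 4 * SC + 1 by rewrite ltr_wpDl// mulr_ge0.
have KA1 : 0 < KA + 1 by rewrite ltr_wpDl.
(* [4 * SC] bounds [psi * c] on the circle, 4 being the bound that [outer_multiplier] gives for
   [psi]. *)
pose del2 := Num.min (e2 / d%:R / (KA + 1)) (e / 2 / d%:R / (4 * SC + 1)).
have del20 : 0 < del2 by rewrite lt_min !divr_gt0// mulr_gt0.
have del2A : d%:R * (KA * del2) <= e2.
  by apply: mul_le_of_divD1; rewrite ?(ltW del20)// ge_min lexx.
have del2C : d%:R * (4 * SC * del2) <= e / 2.
  by apply: mul_le_of_divD1; rewrite ?mulr_ge0 ?(ltW del20)// ge_min lexx orbT.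
have [sm /(_ _ (leqnn _)) hsm] := fin_eventually (fun ij => l2_le_tail (hKm ij) del20).
pose m' i l := \poly_(n < sm) b (l, i) n.
pose u i := \sum_l m' i l * c l.
have [N1 hN1] : exists N0, forall N, (N0 <= N)%N -> forall ij : 'I_d * 'I_d,
    forall (w z : C), N.-primitive_root w -> md z = 1 ->
    \sum_(t < N) md (\sum_l (B ij.1 l).[z * w ^+ t] * (A' l ij.2).[z * w ^+ t]
       - (ij.1 == ij.2)%:R) <= N%:R * (s1 / dd).
  apply: fin_eventually => -[i l] /=.
  have := @grid_L1 R d (fun l' => horner (B i l')) (fun l' => A l' l)
    (fun l' n => (B i l')`_n) (fun l' => a (l', l)) _ (i == l)%:R
    (B i) (fun l' => A' l' l) KB KA KB e1 0 del1 e1 KB0 KA0 KB0 (ltW e10) (lexx _)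
    (ltW del10) e10.
  have hKBh l' : l2_le (fun n => (B i l')`_n) KB by apply: l2_le_sup; exact: hKB (i, l').
  case/(_ _ (fun l' => power_series_poly _) hKBh (fun l' => haA (l', l))
    (fun l' => hKA (l', l)) (hBe i l)) => //.
  - by move=> z _; rewrite addrC subrK.
  - by move=> l'; apply: l2_le_ext (l2_le0 R) => n; rewrite subrr.
  move=> N0 h; exists N0 => N NN w z hw z1; apply: le_trans (h N w z NN hw z1) _.
  rewrite ler_wpM2l// mul0r add0r.
  have : e1 * 3 = s1 / dd by rewrite /e1; field; rewrite gt_eqF.
  lra.
have [N2 hN2] : exists N0, forall N, (N0 <= N)%N -> forall ij : 'I_d * 'I_d,
    forall (w z : C), N.-primitive_root w -> md z = 1 ->
    \sum_(t < N) md (\sum_l (A' ij.1 l).[z * w ^+ t] * (m' l ij.2).[z * w ^+ t]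
       - (ij.1 == ij.2)%:R) <= N%:R * (s2 / dd).
  apply: fin_eventually => -[i l] /=.
  have := @grid_L1 R d (fun l' => A i l') (fun l' => m l l')
    (fun l' => a (i, l')) (fun l' => b (l, l')) _ (i == l)%:R
    (fun l' => A' i l') (fun l' => m' l' l) KA Km KA e2 del1 del2 e2 KA0 Km0 KA0 (ltW e20)
    (ltW del10) (ltW del20) e20.
  case/(_ _ (fun l' => haA (i, l')) (fun l' => hKA (i, l')) (fun l' => hbm (l, l'))
    (fun l' => hKm (l, l')) (hme i l)) => //.
  - by move=> z _; rewrite addrC subrK.
  - by move=> l'; exact: l2_le_trunc.
  move=> N0 h; exists N0 => N NN w z hw z1; apply: le_trans (h N w z NN hw z1) _.
  rewrite ler_wpM2l// mulrDr.
  have : e2 * 4 = s2 / dd by rewrite /e2; field; rewrite gt_eqF.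
  lra.
pose N := (maxn sA (maxn N1 N2)).+1.
have [w hw] := @prim_root_exists R N isT.
have NN1 : (N1 <= N)%N by rewrite leqW// !leq_max leqnn orbT.
have NN2 : (N2 <= N)%N by rewrite leqW// !leq_max leqnn !orbT.
have NsA : (sA <= N)%N by rewrite leqW// leq_max leqnn.
have GM z : md z = 1 ->
    \prod_(t < N) (1 + deviation u j (z * w ^+ t)) <= (1 + k) ^+ N.
  move=> z1.
  pose ev t (X : 'I_d -> 'I_d -> {poly C}) : 'M[C]_d :=
    \matrix_(i, l) (X i l).[z * w ^+ t].
  pose E1 t := mxsum (ev t B *m ev t A' - 1%:M).
  pose E2 t := mxsum (ev t A' *m ev t m' - 1%:M).
  have deteV t X : \det (ev t X) = (\det (\matrix_(i, l) X i l)).[z * w ^+ t].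
    rewrite -[RHS]/(horner_eval _ _) -det_map_mx; congr (\det _).
    by apply/matrixP => i l; rewrite !mxE.
  have pt (t : 'I_N) : 1 + deviation u j (z * w ^+ t) <= (1 + C1 * E1 t * (1 + E1 t) ^+ d) *
      (1 + C2 * E2 t * (1 + mxsum (ev t A')) ^+ d.+1).
    have hb : md (\det (ev t B)) <= SB by rewrite deteV hSB// (grid_mod hw).
    apply: le_trans (det_approx_deviation (ev t A') (ev t m') j hb).
    rewrite lerD2l /deviation; apply: ler_sum => i _.
    rewrite le_eqVlt; apply/orP; left; apply/eqP; congr (md (_ - _)).
    rewrite !mxE horner_sum mulr_sumr; apply: eq_bigr => l _.
    by rewrite !mxE !deteV !hornerM; ring.
  have E10 t : 0 <= E1 t by exact: mxsum_ge0.
  have E20 t : 0 <= E2 t by exact: mxsum_ge0.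
  have sumE (X : nat -> 'M[C]_d) (s : R) :
      (forall i l, \sum_(t < N) md (X t i l) <= N%:R * (s / dd)) ->
      \sum_(t < N) mxsum (X t) <= N%:R * s.
    move=> h; rewrite exchange_big /=.
    apply: (@le_trans _ _ (\sum_(i < d) \sum_(l < d) N%:R * (s / dd))).
      by apply: ler_sum => i _; rewrite exchange_big /=; apply: ler_sum => l _.
    rewrite !sumr_const !card_ord -mulrnA -[leLHS]mulr_natl natrM -/dd mulrCA.
    by rewrite [dd * _]mulrC divfK// gt_eqF.
  have sE1 : \sum_(t < N) E1 t <= N%:R * s1.
    apply: (sumE (fun t => ev t B *m ev t A' - 1%:M)) => i l.
    apply: le_trans (hN1 N NN1 (i, l) w z hw z1).
    apply: ler_sum => t _; rewrite le_eqVlt; apply/orP; left; apply/eqP.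
    by rewrite !mxE; congr (md (_ - _)); apply: eq_bigr => l' _; rewrite !mxE.
  have sE2 : \sum_(t < N) E2 t <= N%:R * s2.
    apply: (sumE (fun t => ev t A' *m ev t m' - 1%:M)) => i l.
    apply: le_trans (hN2 N NN2 (i, l) w z hw z1).
    apply: ler_sum => t _; rewrite le_eqVlt; apply/orP; left; apply/eqP.
    by rewrite !mxE; congr (md (_ - _)); apply: eq_bigr => l' _; rewrite !mxE.
  have sA' : \sum_(t < N) mxsum (ev t A') <= N%:R * (dd * KA).
    apply: (sumE (fun t => ev t A')) => i l; rewrite mulrAC divff ?gt_eqF// mul1r.
    apply: grid_mean => //; under eq_bigr do rewrite mxE.
    apply: (grid_hle hw z1); last exact: l2_le_trunc.
    exact: leq_trans (size_poly _ _) NsA.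
  apply: (@le_trans _ _ (\prod_(t < N) ((1 + C1 * E1 t * (1 + E1 t) ^+ d) *
      (1 + C2 * E2 t * (1 + mxsum (ev t A')) ^+ d.+1)))).
    by apply: ler_prod => t _; rewrite addr_ge0 ?deviation_ge0//= pt.
  rewrite big_split /=.
  apply: (@le_trans _ _ ((1 + k / 3) ^+ N * (1 + k / 3) ^+ N)); last first.
    by rewrite -exprMn; apply: lerXn2r kk; rewrite nnegrE ?mulr_ge0// addr_ge0// ltW.
  apply: ler_pM.
  - apply: prodr_ge0 => t _; rewrite addr_ge0// mulr_ge0 ?exprn_ge0 ?addr_ge0//.
    by rewrite mulr_ge0.
  - apply: prodr_ge0 => t _; rewrite addr_ge0// mulr_ge0 ?exprn_ge0 ?addr_ge0 ?mxsum_ge0//.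
    by rewrite mulr_ge0.
  - apply: hs1' => [t|t||] //; first by rewrite addr_ge0.
      by apply: le_trans sE1 _; rewrite ler_wpM2l.
    rewrite big_split /= sumr_const card_ord -[1 *+ N]/(N%:R) mulr_natr mulr2n.
    by rewrite lerD2l (le_trans sE1)// ler_piMr.
  - apply: hs2 => [t|t||] //; first by rewrite addr_ge0 ?mxsum_ge0.
    rewrite big_split /= sumr_const card_ord -[1 *+ N]/(N%:R) mulrDr mulr1.
    by rewrite lerD2l.
have e20' : 0 <= e / 2 by rewrite divr_ge0// ltW.
have [psi psi4 hpsi] := outer_multiplier hw k0 k1 e20' ke GM.
(* The true columns [m] replace their truncations, which need not come from [MM]. *)
exists (fun i z => \sum_l m l i z * (psi * c l).[z]).
  exact: (@hMM m hmM (fun l => psi * c l)).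
move=> i.
have hsum : H2le (fun z => \sum_l (psi * c l).[z] * (m l i z - (m' i l).[z])) (e / 2).
  have h := @H2le_sum R _ (index_enum 'I_d)
    (fun l z => (psi * c l).[z] * (m l i z - (m' i l).[z]))
    (fun=> 4 * SC * del2).
  apply: H2le_le (h _ _).
  - by apply: sumr_ge0 => l _; rewrite !mulr_ge0// ltW.
  - by rewrite sumr_const card_ord -[leLHS]mulr_natl.
  - by move=> l; rewrite !mulr_ge0// ltW.
  move=> l; apply: H2leM; first exact: ltW.
    by move=> z z1; rewrite hornerM modulusM; apply: ler_pM; rewrite ?modulus_ge0 ?psi4 ?hSC.
  exists (fun n => b (l, i) n - (m' i l)`_n); last exact: hsm (l, i).
  apply: power_series_ext (power_series_eq _ (power_seriesD (hbm (l, i))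
    (power_series_poly (- m' i l)))).
    by move=> z _; rewrite hornerN.
  by move=> n; rewrite coefN.
have hpsiu : H2le (fun z => (psi * u i - (i == j)%:R%:P).[z]) (e / 2).
  exists (fun n => (psi * u i - (i == j)%:R%:P)`_n); last exact: hpsi.
  exact: power_series_poly.
apply: H2le_ext (H2le_le _ _ (H2leD e20' e20' hsum hpsiu)); last 2 first.
- by rewrite addr_ge0.
- by rewrite -splitr.
move=> z _; rewrite hornerD hornerN hornerC addrA; congr (_ - _).
rewrite hornerM /u horner_sum mulr_sumr -big_split /=; apply: eq_bigr => l _.
by rewrite !hornerM; ring.
Qed.

End Core.

(** * Unordered sums and Hardy spaces *)

Section UnorderedSums.
Variable R : realType.
Local Notation C := R[i].
Local Notation md := (@modulus R).

(** Duplicate-free lists play the finite subsets, and errors are real numbers rather than positive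
    elements of [R[i]]; [csumE] ties this to [csum]. *)
Definition sums_to (J : countType) (a : J -> C) (L : C) :=
  forall e : R, 0 < e -> exists2 s0, uniq s0 &
    forall s, uniq s -> {subset s0 <= s} -> md (L - \sum_(i <- s) a i) <= e.

Definition abs_le (J : countType) (a : J -> C) (B : R) :=
  forall s, uniq s -> \sum_(i <- s) md (a i) <= B.

Definition sq_le (J : countType) (x : J -> C) (K : R) :=
  forall s, uniq s -> \sum_(i <- s) md (x i) ^+ 2 <= K ^+ 2.

Lemma csumE (J : countType) (a : J -> C) L : sums_to a L -> csum a = L.
Proof.
move=> h; rewrite /csum /summability.sum.
have FF := @summability.totally_filter J.
have HH := @norm_hausdorff _ (C^o : normedModType C).
apply: (@cvg_lim (C^o : normedModType C) HH _ _ FF).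
apply/(@cvgrPdist_le _ (C^o : normedModType C)) => /= eps eps0.
(* In the order of [R[i]] a positive element is real. *)
have e0 : 0 < complex.Re eps by move: eps0; rewrite ltcE => /andP[].
have epsE : eps = (complex.Re eps)%:C%C.
  move: eps0; rewrite ltcE => /andP[/eqP h0 _].
  by move: h0 => /=; case: eps {e0} => a' b' /= ->.
have [s0 us0 hs0] := h _ e0.
exists (finmap.seq_fset tt s0) => // B sB.
rewrite /summability.partial_sum -(finmap.big_seq_fsetE _ B predT a) epsE /= -modulusE lecR.
apply: hs0; first exact: finmap.fset_uniq.
move=> x xs; apply: (finmap.fsubsetP sB); by rewrite finmap.seq_fsetE.
Qed.

Lemma big_uniq_subset (J : eqType) (s0 s : seq J) (b : J -> R) :
  uniq s0 -> uniq s -> {subset s0 <= s} -> (forall i, 0 <= b i) ->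
  \sum_(i <- s0) b i <= \sum_(i <- s) b i.
Proof.
move=> us0 us s0s b0; rewrite [leRHS](bigID (mem s0)) /=.
have p0 : perm_eq s0 [seq i <- s | i \in s0].
  apply: uniq_perm => //; first exact: filter_uniq.
  by move=> i; rewrite mem_filter; case is0 : (i \in s0) => //=; rewrite s0s.
rewrite (perm_big _ p0) big_filter lerDl.
exact: sumr_ge0.
Qed.

Lemma sums_toD (J : countType) (a b : J -> C) L M :
  sums_to a L -> sums_to b M -> sums_to (fun i => a i + b i) (L + M).
Proof.
move=> ha hb e e0; have e2 : 0 < e / 2 by rewrite divr_gt0.
have [s1 us1 h1] := ha _ e2; have [s2 us2 h2] := hb _ e2.
exists (undup (s1 ++ s2)); first exact: undup_uniq.
move=> s us ss; rewrite big_split /= opprD addrACA [e]splitr.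
apply: le_trans (modulusD _ _) _; apply: lerD.
  by apply: h1 => // i is1; apply: ss; rewrite mem_undup mem_cat is1.
by apply: h2 => // i is2; apply: ss; rewrite mem_undup mem_cat is2 orbT.
Qed.

Lemma sums_toZ (J : countType) c (a : J -> C) L :
  sums_to a L -> sums_to (fun i => c * a i) (c * L).
Proof.
move=> ha e e0; have c0 : 0 < md c + 1 by rewrite ltr_wpDl// modulus_ge0.
have [s0 us0 h0] := ha _ (divr_gt0 e0 c0).
exists s0 => // s us ss; rewrite -mulr_sumr -mulrBr modulusM.
have := h0 s us ss; rewrite ler_pdivlMr//; apply: le_trans.
by rewrite mulrC ler_wpM2l ?modulus_ge0// lerDl.
Qed.

Lemma sums_to_eq (J : countType) (a b : J -> C) L : a =1 b ->
  sums_to a L -> sums_to b L.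
Proof. by move=> /funext ->. Qed.

Lemma sums_to_fin (J : countType) (a : J -> C) s0 : uniq s0 ->
  (forall i, i \notin s0 -> a i = 0) -> sums_to a (\sum_(i <- s0) a i).
Proof.
move=> us0 h e e0; exists s0 => // s us ss.
have p0 : perm_eq s0 [seq i <- s | i \in s0].
  apply: uniq_perm => //; first exact: filter_uniq.
  by move=> i; rewrite mem_filter; case is0 : (i \in s0) => //=; rewrite ss.
rewrite (perm_big _ p0) big_filter.
rewrite [X in _ - X](bigID (mem s0)) /= [X in _ - (_ + X)]big1 ?addr0; last first.
  by move=> i /h.
by rewrite subrr modulus0 ltW.
Qed.

Lemma sums_to_ge0 (J : countType) (b : J -> R) B : (forall i, 0 <= b i) ->
  (forall s, uniq s -> \sum_(i <- s) b i <= B) ->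
  exists L, sums_to (fun i => (b i)%:C%C) L.
Proof.
move=> b0 hB; pose S := [set x : R | exists2 s, uniq s & x = \sum_(i <- s) b i]%classic.
have hS : has_sup S.
  split; first by exists 0, [::]; rewrite ?big_nil.
  by exists B => _ [s us ->]; exact: hB.
exists (sup S)%:C%C => e e0.
have [_ [s0 us0 ->] hs0] := sup_adherent e0 hS.
exists s0 => // s us ss; rewrite -rmorph_sum -rmorphB modulus_real.
  rewrite lerBlDr -lerBlDl (le_trans (ltW hs0))//.
  exact: big_uniq_subset.
rewrite subr_ge0; apply: ub_le_sup; first exact: hS.2.
by exists s.
Qed.

Lemma modulus_ReIm (z : C) : `|complex.Re z| <= md z /\ `|complex.Im z| <= md z.
Proof.
case: z => x y /=; split; rewrite -sqrtr_sqr; apply: ler_wsqrtr.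
  by rewrite lerDl sqr_ge0.
by rewrite lerDr sqr_ge0.
Qed.

Lemma abs_le_dom (J : countType) (b : J -> R) (a : J -> C) B s : uniq s ->
  (forall i, b i <= md (a i)) -> abs_le a B -> \sum_(i <- s) b i <= B.
Proof. by move=> us ba h; apply: le_trans (h s us); apply: ler_sum. Qed.

(** Real and imaginary parts are split into positive and negative parts, whose finite sums have a
    supremum. *)
Lemma sums_to_abs (J : countType) (a : J -> C) B : abs_le a B ->
  exists L, sums_to a L.
Proof.
move=> h.
have real (b : J -> R) : (forall i, `|b i| <= md (a i)) ->
    exists L, sums_to (fun i => (b i)%:C%C) L.
  move=> hb.
  have [||L1 h1] := @sums_to_ge0 J (fun i => (`|b i| + b i) / 2) B.
  - by move=> i; rewrite divr_ge0//; have := ler_norm (- b i); rewrite normrN; lra.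
  - move=> s us; apply: abs_le_dom us _ h => i; apply: le_trans (hb i).
    by have := ler_norm (b i); lra.
  have [||L2 h2] := @sums_to_ge0 J (fun i => (`|b i| - b i) / 2) B.
  - by move=> i; rewrite divr_ge0//; have := ler_norm (b i); lra.
  - move=> s us; apply: abs_le_dom us _ h => i; apply: le_trans (hb i).
    by have := ler_norm (- b i); rewrite normrN; lra.
  exists (L1 + -1 * L2); apply: sums_to_eq (sums_toD h1 (sums_toZ (-1) h2)) => i.
  by rewrite mulN1r -rmorphN -rmorphD /=; congr (_%:C%C); lra.
have [L1 h1] := real (fun i => complex.Re (a i)) (fun i => (modulus_ReIm (a i)).1).
have [L2 h2] := real (fun i => complex.Im (a i)) (fun i => (modulus_ReIm (a i)).2).
exists (L1 + 'i%C * L2); apply: sums_to_eq (sums_toD h1 (sums_toZ 'i%C h2)) => i.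
by rewrite [RHS]complexE.
Qed.

Lemma sums_to_le (J : countType) (a : J -> C) B L : abs_le a B -> sums_to a L ->
  md L <= B.
Proof.
move=> h hL; apply/ler_addgt0Pr => e e0; have [s us hs] := hL e e0.
have := hs s us (fun _ => id); have := h s us.
have : md L <= md (L - \sum_(i <- s) a i) + md (\sum_(i <- s) a i).
  by rewrite (le_trans _ (modulusD _ _))// subrK.
have := modulus_sum s xpredT a; lra.
Qed.

Lemma csum_sums (J : countType) (a : J -> C) B : abs_le a B -> sums_to a (csum a).
Proof. by move=> /sums_to_abs[L hL]; rewrite (csumE hL). Qed.

Lemma csum_le (J : countType) (a : J -> C) B : abs_le a B -> md (csum a) <= B.
Proof. by move=> h; apply: sums_to_le h (csum_sums h). Qed.

Lemma sq_le_abs (J : countType) (x y : J -> C) K L : 0 <= K -> 0 <= L ->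
  sq_le x K -> sq_le y L -> abs_le (fun i => x i * y i) (K * L).
Proof.
move=> K0 L0 hx hy s us; under eq_bigr do rewrite modulusM.
by apply: CauchySchwarz_sum => //; [exact: hx|exact: hy].
Qed.

Lemma sqnorm_le (J : countType) (x : J -> C) K : 
  (sqnorm x <= (K ^+ 2)%:E)%E <-> sq_le x K.
Proof.
have sumE s : uniq s -> (\sum_(i \in [set` s]%classic) (md (x i) ^+ 2)%:E =
    (\sum_(i <- s) md (x i) ^+ 2)%:E)%E.
  by move=> us; rewrite -fsbig_seq// sumEFin.
split => [h s us|h].
  rewrite -lee_fin -sumE//; apply: le_trans h; apply: esum_ge.
  by exists [set` s]%classic => //; split => //; exact: finite_seq.
apply: ge_ereal_sup => _ [A [fA _] <-].
rewrite (fsbig_finite _ _ fA) sumEFin lee_fin; apply: h; exact: finmap.fset_uniq.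
Qed.

Lemma sqnorm_ge0 (J : countType) (x : J -> C) : (0 <= sqnorm x)%E.
Proof. by apply: esum_ge0 => i _; rewrite lee_fin sqr_ge0. Qed.

Lemma ell2P (J : countType) (x : J -> C) : ell2 x <-> exists2 K, 0 <= K & sq_le x K.
Proof.
split => [|[K K0 /sqnorm_le h]]; last exact: le_lt_trans h (ltry _).
rewrite /ell2; have := sqnorm_ge0 x; case E : sqnorm => [r| |] //.
rewrite lee_fin => r0 _; exists (Num.sqrt r); rewrite ?sqrtr_ge0//.
by apply/sqnorm_le; rewrite E sqr_sqrtr.
Qed.

End UnorderedSums.

(** * From vector-valued Hardy spaces to scalar coefficient bounds *)

Section Translation.
Variable R : realType.
Local Notation C := R[i].
Local Notation md := (@modulus R).

Lemma cvg0e_sqP (u : nat -> \bar R) : (forall n, 0 <= u n)%E ->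
  (u n @[n --> \oo] --> 0%E)%classic <->
  forall e : R, 0 < e -> exists N0, forall N, (N0 <= N)%N -> (u N <= (e ^+ 2)%:E)%E.
Proof.
move=> u0; split => [h e e0|h].
  have /fine_cvgP[[N1 _ h1] /cvgrPdist_le/(_ (e ^+ 2))] := h.
  case; first by rewrite exprn_gt0.
  move=> N2 _ h2; exists (maxn N1 N2) => N; rewrite geq_max => /andP[n1 n2].
  rewrite -[u N]fineK ?h1// lee_fin.
  by have := h2 N n2; rewrite /= sub0r normrN ger0_norm// fine_ge0.
apply/fine_cvgP; split.
  have [N0 h0] := h 1 ltr01; exists N0 => // N /= NN.
  by rewrite ge0_fin_numE//; apply: le_lt_trans (h0 N NN) (ltry _).
apply/cvgrPdist_le => e e0.
have se0 : 0 < Num.sqrt e by rewrite sqrtr_gt0.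
have [N0 h0] := h _ se0; exists N0 => // N /= NN.
rewrite sub0r normrN ger0_norm ?fine_ge0//.
have := h0 N NN; rewrite sqr_sqrtr ?(ltW e0)// => h1.
by rewrite -lee_fin fineK// ge0_fin_numE//; apply: le_lt_trans h1 (ltry _).
Qed.

Lemma nneseries_le (u : nat -> \bar R) (B : \bar R) : (forall n, 0 <= u n)%E ->
  (forall N, \sum_(n < N) u n <= B)%E -> (\sum_(0 <= n <oo) u n <= B)%E.
Proof.
move=> u0 h; apply: lime_le; first by apply: is_cvg_nneseries => n _ _.
by near=> N; rewrite big_mkord.
Unshelve. all: by end_near. Qed.

Lemma nneseries_ge (u : nat -> \bar R) N : (forall n, 0 <= u n)%E ->
  (\sum_(n < N) u n <= \sum_(0 <= n <oo) u n)%E.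
Proof. by move=> u0; rewrite -(big_mkord xpredT u); exact: nneseries_lim_ge. Qed.

Lemma sqnorm_entry (J : countType) (x : J -> C) i :
  ((md (x i) ^+ 2)%:E <= sqnorm x)%E.
Proof.
apply: esum_ge; exists [set i]%classic; last by rewrite fsbig_set1.
by split => //; exact: finite_set1.
Qed.

Lemma sq_le_mono (J : countType) (x : J -> C) K L : 0 <= K -> K <= L ->
  sq_le x K -> sq_le x L.
Proof.
move=> K0 KL h s us; apply: le_trans (h s us) _.
by rewrite ler_sqr ?nnegrE// (le_trans K0).
Qed.

Lemma sq_leD (J : countType) (x y : J -> C) K L : 0 <= K -> 0 <= L ->
  sq_le x K -> sq_le y L -> sq_le (fun i => x i + y i) (K + L).
Proof.
move=> K0 L0 hx hy s us.
apply: le_trans (Minkowski_sum K0 L0 (hx s us) (hy s us)).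
apply: ler_sum => i _; rewrite ler_sqr ?nnegrE ?addr_ge0 ?modulus_ge0//.
exact: modulusD.
Qed.

Lemma sq_leZ (J : countType) c (x : J -> C) K :
  sq_le x K -> sq_le (fun i => c * x i) (md c * K).
Proof.
move=> hx s us; under eq_bigr do rewrite modulusM exprMn.
by rewrite -mulr_sumr exprMn ler_wpM2l ?sqr_ge0// hx.
Qed.

Lemma ell2D (J : countType) (x y : J -> C) :
  ell2 x -> ell2 y -> ell2 (fun i => x i + y i).
Proof.
move=> /ell2P[K K0 hK] /ell2P[L L0 hL]; apply/ell2P.
by exists (K + L); [exact: addr_ge0|exact: sq_leD].
Qed.

Lemma ell2Z (J : countType) c (x : J -> C) : ell2 x -> ell2 (fun i => c * x i).
Proof.
move=> /ell2P[K K0 hK]; apply/ell2P; exists (md c * K); last exact: sq_leZ.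
by rewrite mulr_ge0// modulus_ge0.
Qed.

Lemma ell2_0 (J : countType) : ell2 (fun _ : J => 0 : C).
Proof.
by apply/ell2P; exists 0 => // s _; rewrite big1 ?expr0n// => i _; rewrite modulus0 expr0n.
Qed.

Lemma ell2_sum (J : countType) (I : Type) (r : seq I) (x : I -> J -> C) :
  (forall l, ell2 (x l)) -> ell2 (fun i => \sum_(l <- r) x l i).
Proof.
move=> h; elim: r => [|l r IH].
  have -> : (fun i => \sum_(l <- [::]) x l i) = fun=> 0 by apply/funext => i; rewrite big_nil.
  exact: ell2_0.
have -> : (fun i => \sum_(l' <- l :: r) x l' i) = fun i => x l i + \sum_(l <- r) x l i.
  by apply/funext => i; rewrite big_cons.
exact: ell2D.
Qed.

Definition unit_vec (J : countType) (j : J) : J -> C := fun k => (k == j)%:R.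

Lemma sq_le_unit (J : countType) (j : J) : sq_le (unit_vec j) 1.
Proof.
move=> s us; rewrite expr1n; have [js|js] := boolP (j \in s).
  rewrite (bigD1_seq j)//= /unit_vec eqxx modulus1 expr1n big1 ?addr0// => k /negbTE ->.
  by rewrite modulus0 expr0n.
rewrite big1_seq// => k /andP[_ ks]; rewrite /unit_vec.
by case: eqP ks js => [-> ->//|_ _ _]; rewrite modulus0 expr0n.
Qed.

Lemma ell2_unit (J : countType) (j : J) : ell2 (unit_vec j).
Proof. by apply/ell2P; exists 1 => //; exact: sq_le_unit. Qed.

Lemma mxapp_unit (I J : countType) (A : opmx R I J) j : mxapp A (unit_vec j) =
  fun i => A i j.
Proof.
apply/funext => i; rewrite /mxapp /unit_vec.
rewrite (csumE (sums_to_fin (s0 := [:: j]) _ _))//.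
  by rewrite big_seq1 eqxx mulr1.
by move=> k; rewrite inE => /negbTE ->; rewrite mulr0.
Qed.

Lemma csum_enum (J : countType) k (h : 'I_k -> J) (a : J -> C) : injective h ->
  (forall j, exists l, h l = j) -> csum a = \sum_l a (h l).
Proof.
move=> hi hs; rewrite -[RHS](big_map h xpredT a).
apply: csumE; apply: sums_to_fin.
  by rewrite map_inj_uniq// index_enum_uniq.
move=> j; have [l <-] := hs j.
by rewrite mem_map// mem_index_enum.
Qed.

Lemma csum_ord k (a : 'I_k -> C) : csum a = \sum_l a l.
Proof. by apply: (@csum_enum _ _ id) => // j; exists j. Qed.

Lemma sums_to_sum (J : countType) (I : Type) (r : seq I) (g : I -> C)
    (t : I -> J -> C) : (forall l, exists B, abs_le (t l) B) ->
  sums_to (fun i => \sum_(l <- r) g l * t l i) (\sum_(l <- r) g l * csum (t l)).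
Proof.
move=> h; elim: r => [|l r IH].
  have := @sums_to_fin R J (fun=> 0) [::] isT (fun _ _ => erefl).
  by rewrite !big_nil; apply: sums_to_eq => i; rewrite big_nil.
rewrite big_cons; have [B hB] := h l.
apply: sums_to_eq (sums_toD (sums_toZ (g l) (csum_sums hB)) IH) => i.
by rewrite big_cons.
Qed.

Lemma csum_sum (J : countType) (I : Type) (r : seq I) (g : I -> C)
    (t : I -> J -> C) : (forall l, exists B, abs_le (t l) B) ->
  csum (fun i => \sum_(l <- r) g l * t l i) = \sum_(l <- r) g l * csum (t l).
Proof. by move=> h; apply: csumE; exact: sums_to_sum. Qed.

Lemma ell2_abs (J : countType) (x y : J -> C) : ell2 x -> ell2 y ->
  exists B, abs_le (fun i => x i * y i) B.
Proof.
move=> /ell2P[K K0 hK] /ell2P[L L0 hL]; exists (K * L).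
exact: sq_le_abs.
Qed.

Section Expansion.
Variables (I : countType) (f : C -> I -> C) (a : nat -> I -> C).
Hypothesis ha : power_expansion f a.

Lemma expansion_remainder z : in_disk z -> forall e : R, 0 < e ->
  exists N0, forall N, (N0 <= N)%N ->
    sq_le (fun i => f z i - \sum_(n < N) z ^+ n * a n i) e.
Proof.
move=> z1 e e0.
have [N0 h0] := (cvg0e_sqP (fun=> sqnorm_ge0 _)).1 (ha.2 z z1) e e0.
by exists N0 => N NN; apply/sqnorm_le; exact: h0.
Qed.

Lemma expansion_ell2 z : in_disk z -> ell2 (f z).
Proof.
move=> z1; have [N0 /(_ _ (leqnn _)) h] := expansion_remainder z1 ltr01.
rewrite (_ : f z = fun i => (f z i - \sum_(n < N0) z ^+ n * a n i) +
  \sum_(n < N0) z ^+ n * a n i); last first.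
  by apply/funext => i; rewrite subrK.
apply: ell2D; first by apply/ell2P; exists 1.
by apply: ell2_sum => n; apply: ell2Z; exact: ha.1.
Qed.

Lemma expansion_entry i : power_series (fun z => f z i) (fun n => a n i).
Proof.
move=> z z1 e e0; have [N0 h0] := expansion_remainder z1 e0.
exists N0 => N NN; have := h0 N NN [:: i] isT.
by rewrite big_seq1 ler_sqr ?nnegrE ?modulus_ge0 ?(ltW e0).
Qed.

Lemma expansion_hle i K : (\sum_(0 <= n <oo) sqnorm (a n) <= (K ^+ 2)%:E)%E ->
  l2_le (fun n => a n i) K.
Proof.
move=> h N; rewrite -lee_fin; apply: le_trans h.
apply: le_trans (nneseries_ge N _); last by move=> n; exact: sqnorm_ge0.
by rewrite -sumEFin; apply: lee_sum => n _; exact: sqnorm_entry.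
Qed.

(** Bilinear pairing with a fixed vector sends the expansion to the scalar series with coefficients
    [csum (a n * x)], bounded by [||a n|| X]; [kap n] is the norm of [a n]. *)
Lemma expansion_csum K (x : I -> C) X : 0 <= K -> 0 <= X ->
  (\sum_(0 <= n <oo) sqnorm (a n) <= (K ^+ 2)%:E)%E -> sq_le x X ->
  H2le (fun z => csum (fun i => f z i * x i)) (K * X).
Proof.
move=> K0 X0 hK hx.
have x2 : ell2 x by apply/ell2P; exists X.
pose kap n := Num.sqrt (fine (sqnorm (a n))).
have kap0 n : 0 <= kap n by exact: sqrtr_ge0.
have kapE n : (kap n ^+ 2)%:E = sqnorm (a n).
  rewrite sqr_sqrtr ?fine_ge0 ?sqnorm_ge0// fineK// ge0_fin_numE ?sqnorm_ge0//.
  exact: ha.1.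
have ka n : sq_le (a n) (kap n) by apply/sqnorm_le; rewrite kapE.
exists (fun n => csum (fun i => a n i * x i)).
  move=> z z1 e e0.
  have X1 : 0 < X + 1 by rewrite ltr_wpDl.
  have [N0 h0] := expansion_remainder z1 (divr_gt0 e0 X1).
  exists N0 => N NN; have hN := h0 N NN.
  have e1 : 0 <= e / (X + 1) by rewrite divr_ge0// ltW.
  have := csum_le (sq_le_abs e1 X0 hN hx).
  rewrite (_ : csum _ = csum (fun i => f z i * x i) -
      \sum_(n < N) z ^+ n * csum (fun i => a n i * x i)).
    move=> h; apply: le_trans h _; rewrite mulrAC ler_pdivrMr//.
    by rewrite ler_wpM2l ?(ltW e0)// lerDl.
  apply: csumE.
  have [B hB] := ell2_abs (expansion_ell2 z1) x2.
  have s2 : sums_to (fun i => \sum_(n < N) z ^+ n * (a n i * x i))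
      (\sum_(n < N) z ^+ n * csum (fun i => a n i * x i)).
    by apply: sums_to_sum => n; apply: ell2_abs x2; exact: ha.1.
  rewrite -[X in _ + X]mulN1r.
  apply: sums_to_eq (sums_toD (csum_sums hB) (sums_toZ (-1) s2)) => i.
  rewrite mulN1r mulrBl mulr_suml; congr (_ - _).
  by apply: eq_bigr => n _; rewrite mulrA.
move=> N; apply: (@le_trans _ _ (\sum_(n < N) kap n ^+ 2 * X ^+ 2)).
  apply: ler_sum => n _; rewrite -exprMn ler_sqr ?nnegrE ?modulus_ge0 ?mulr_ge0//.
  by apply: csum_le; exact: sq_le_abs.
rewrite -mulr_suml exprMn ler_wpM2r ?sqr_ge0// -lee_fin; apply: le_trans hK.
apply: le_trans (nneseries_ge N _); last by move=> n; exact: sqnorm_ge0.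
by rewrite -sumEFin; apply: lee_sum => n _; rewrite kapE.
Qed.

End Expansion.

Lemma nneseries_sq (u : nat -> \bar R) : (forall n, 0 <= u n)%E ->
  (\sum_(0 <= n <oo) u n < +oo)%E ->
  exists2 K : R, 0 <= K & (\sum_(0 <= n <oo) u n <= (K ^+ 2)%:E)%E.
Proof.
move=> u0 h; have s0 : (0 <= \sum_(0 <= n <oo) u n)%E by apply: nneseries_ge0 => n _ _.
exists (Num.sqrt (fine (\sum_(0 <= n <oo) u n)%E)); first exact: sqrtr_ge0.
by rewrite sqr_sqrtr ?fine_ge0// fineK// ge0_fin_numE.
Qed.

Lemma H2_entry (I : countType) (f : C -> I -> C) i : H2 f ->
  exists2 K, 0 <= K & H2le (fun z => f z i) K.
Proof.
move=> [a ha /(nneseries_sq (fun=> sqnorm_ge0 _))[K K0 hK]].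
by exists K => //; exists (fun n => a n i);
  [exact: expansion_entry|exact: expansion_hle hK].
Qed.

Lemma H2norm_lt_entry (I : countType) (f : C -> I -> C) i e : H2norm_lt f e ->
  H2le (fun z => f z i) e.
Proof.
move=> [a ha /ltW hK]; exists (fun n => a n i); first exact: expansion_entry.
exact: expansion_hle hK.
Qed.

Lemma H2_csum (I : countType) (f : C -> I -> C) x : H2 f -> ell2 x ->
  exists2 K, 0 <= K & H2le (fun z => csum (fun i => f z i * x i)) K.
Proof.
move=> [a ha /(nneseries_sq (fun=> sqnorm_ge0 _))[K K0 hK]] /ell2P[X X0 hx].
exists (K * X); first exact: mulr_ge0.
exact: (expansion_csum ha).
Qed.

Lemma H2_ell2 (I : countType) (f : C -> I -> C) z : H2 f -> in_disk z -> ell2 (f z).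
Proof. by move=> [a ha _] z1; exact: expansion_ell2 ha z z1. Qed.

Lemma H2le_at0 f K : 0 <= K -> H2le f K -> md (f 0) <= K.
Proof.
move=> K0 [a ha hK].
have /(power_series_le K0 (fun n => l2_le_coef n K0 hK) ltr01) := ha.
by move=> h; have := h 0; rewrite subr0 divr1; apply; rewrite modulus0.
Qed.

Lemma H2_const (I : countType) (x : I -> C) : ell2 x -> H2 (fun=> x).
Proof.
move=> hx; exists (fun n => if n == 0%N then x else fun=> 0).
  split => [[|n]//|z z1]; first exact: ell2_0.
  apply/cvg0e_sqP; first by move=> n; exact: sqnorm_ge0.
  move=> e e0; exists 1%N => -[//|N] _; apply/sqnorm_le => s us.
  rewrite big1 ?sqr_ge0// => i _; rewrite big_ord_recl big1 ?addr0.
    by rewrite expr0 mul1r subrr modulus0 expr0n.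
  by move=> n _; rewrite mulr0.
apply: le_lt_trans hx; apply: nneseries_le; first by move=> n; exact: sqnorm_ge0.
move=> [|N]; first by rewrite big_ord0 sqnorm_ge0.
rewrite big_ord_recl big1 ?adde0// => n _; apply/eqP.
rewrite eq_le sqnorm_ge0 andbT.
have : (sqnorm (fun _ : I => 0%R : C) <= (0 ^+ 2)%:E)%E.
  by apply/sqnorm_le => s _; rewrite expr0n big1// => i _; rewrite modulus0 expr0n.
by rewrite expr0n.
Qed.

End Translation.

(** * Finite-dimensional targets *)

Section FiniteIndex.
Variables (R : realType) (E : countType) (k : nat) (h : 'I_k -> E).
Local Notation C := R[i].
Local Notation md := (@modulus R).
Hypotheses (h_inj : injective h) (h_surj : forall e, exists l, h l = e).

Lemma sqnorm_fin (y : E -> C) :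
  (sqnorm y <= (\sum_l md (y (h l)) ^+ 2)%:E)%E.
Proof.
have s0 : 0 <= \sum_l md (y (h l)) ^+ 2 by apply: sumr_ge0 => l _; exact: sqr_ge0.
rewrite -[X in X%:E]sqr_sqrtr//; apply/sqnorm_le => s us; rewrite sqr_sqrtr//.
rewrite -(big_map h xpredT (fun e => md (y e) ^+ 2)).
apply: big_uniq_subset => //.
- by rewrite map_inj_uniq// index_enum_uniq.
- by move=> e _; have [l <-] := h_surj e; rewrite mem_map// mem_index_enum.
- by move=> e; exact: sqr_ge0.
Qed.

Lemma sum_const_le (x : 'I_k -> R) (Y : R) : (forall l, x l <= Y ^+ 2) ->
  \sum_l x l <= (k%:R * Y) ^+ 2.
Proof.
move=> hx; apply: (@le_trans _ _ (\sum_(l < k) Y ^+ 2)); first exact: ler_sum.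
rewrite sumr_const card_ord -[leLHS]mulr_natl exprMn ler_wpM2r ?sqr_ge0//.
by rewrite -natrX ler_nat; case: (k) => // n; rewrite leq_pmull.
Qed.

Lemma sq_le_fin (y : E -> C) (Y : R) : (forall l, md (y (h l)) <= Y) ->
  sq_le y (k%:R * Y).
Proof.
move=> hy; apply/sqnorm_le; apply: le_trans (sqnorm_fin y) _; rewrite lee_fin.
apply: sum_const_le => l; have := hy l; have := modulus_ge0 (y (h l)); nra.
Qed.

Lemma expansion_of_entries (f : C -> E -> C) (K : R) : 0 <= K ->
  (forall l, H2le (fun z => f z (h l)) K) ->
  exists2 a, power_expansion f a &
    (\sum_(0 <= n <oo) sqnorm (a n) <= ((k%:R * K) ^+ 2)%:E)%E.
Proof.
move=> K0 /fin_all_exists2[b hb hK].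
pose g e := sval (cid (h_surj e)).
have hg e : h (g e) = e by rewrite /g; case: cid.
have gh l : g (h l) = l by apply: h_inj; rewrite hg.
exists (fun n e => b (g e) n).
  split => [n|z z1].
    apply/ell2P; exists (k%:R * K); first exact: mulr_ge0.
    by apply: sq_le_fin => l; rewrite gh; exact: l2_le_coef.
  apply/cvg0e_sqP; first by move=> n; exact: sqnorm_ge0.
  move=> e e0; have k1 : 0 < k%:R + 1 :> R by rewrite ltr_wpDl.
  have [N0 h0] := fin_eventually (fun l => hb l z z1 _ (divr_gt0 e0 k1)).
  exists N0 => N NN; apply/sqnorm_le.
  apply: (@sq_le_mono _ _ _ (k%:R * (e / (k%:R + 1)))).
  - by rewrite mulr_ge0// divr_ge0// ltW.
  - by rewrite mulrCA ler_piMr ?(ltW e0)// ler_pdivrMr// mul1r lerDl.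
  apply: sq_le_fin => l.
  by under eq_bigr do rewrite gh; exact: h0.
apply: nneseries_le; first by move=> n; exact: sqnorm_ge0.
move=> N; apply: (@le_trans _ _ (\sum_(n < N) (\sum_l md (b l n) ^+ 2)%:E)%E).
  apply: lee_sum => n _; apply: le_trans (sqnorm_fin _) _.
  by under eq_bigr do rewrite gh.
rewrite sumEFin lee_fin exchange_big /=.
by apply: sum_const_le => l; exact: hK.
Qed.

Lemma H2_of_entries (f : C -> E -> C) :
  (forall l, exists2 K, 0 <= K & H2le (fun z => f z (h l)) K) -> H2 f.
Proof.
move=> /(fin_bound (P := fun l K => H2le (fun z => f z (h l)) K))[|K K0 hK].
  by move=> l K L; exact: H2le_le.
have [a ha hs] := expansion_of_entries K0 hK.
by exists a => //; apply: le_lt_trans hs (ltry _).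
Qed.

Lemma H2norm_lt_of_entries (f : C -> E -> C) (K e : R) : 0 <= K ->
  k%:R * K < e -> (forall l, H2le (fun z => f z (h l)) K) -> H2norm_lt f e.
Proof.
move=> K0 Ke hK; have [a ha hs] := expansion_of_entries K0 hK.
exists a => //; apply: le_lt_trans hs _; rewrite lte_fin.
have kK : 0 <= k%:R * K by rewrite mulr_ge0.
by rewrite ltr_sqr ?nnegrE// (le_trans kK (ltW Ke)).
Qed.

Lemma abs_le_summable (J : countType) (a : J -> C) B : abs_le a B ->
  summable [set: J]%classic (fun j => (md (a j))%:E).
Proof.
move=> hB; rewrite /summable; apply: (@le_lt_trans _ _ B%:E); last exact: ltry.
apply: ge_ereal_sup => _ [A [fA _] <-].
rewrite (fsbig_finite _ _ fA) /=.
under eq_bigr do rewrite ger0_norm ?modulus_ge0//.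
by rewrite sumEFin lee_fin; apply: hB; exact: finmap.fset_uniq.
Qed.

(** Each of the [k] output entries is bounded by Cauchy-Schwarz; [k] replaces its square root to
    keep constants simple. *)
Lemma opnorm_rows (J : countType) (A : opmx R E J) (K M : R) : 0 <= K ->
  k%:R * K <= M -> (forall l, sq_le (A (h l)) K) -> opnorm_le A M.
Proof.
move=> K0 KM hA; have kK : 0 <= k%:R * K by rewrite mulr_ge0.
split; first exact: le_trans KM.
move=> x hx.
have s0 := sqnorm_ge0 x.
pose X := Num.sqrt (fine (sqnorm x)).
have X0 : 0 <= X by exact: sqrtr_ge0.
have XE : sqnorm x = (X ^+ 2)%:E.
  by rewrite sqr_sqrtr ?fine_ge0// fineK// ge0_fin_numE.
have hX : sq_le x X by apply/sqnorm_le; rewrite XE.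
have hab l : abs_le (fun j => A (h l) j * x j) (K * X) by exact: sq_le_abs.
split; first by move=> e; have [l <-] := h_surj e; exact: abs_le_summable.
rewrite XE -EFinM -exprMn; apply/sqnorm_le.
apply: (@sq_le_mono _ _ _ (k%:R * (K * X))); first by rewrite !mulr_ge0.
  by rewrite mulrA ler_wpM2r.
by apply: sq_le_fin => l; exact: csum_le.
Qed.

End FiniteIndex.

(** * Vector polynomials as a module over scalar polynomials *)

Section Polynomials.
Variable R : realType.
Local Notation C := R[i].
Local Notation md := (@modulus R).

Lemma H2poly_pad (I : countType) (q : C -> I -> C) : H2poly q ->
  exists (N : nat) (c : nat -> I -> C), (forall n, ell2 (c n)) /\
    forall M, (N <= M)%N -> forall z i, q z i = \sum_(n < M) z ^+ n * c n i.
Proof.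
move=> [N [c [hc ->]]].
exists N, (fun n i => if (n < N)%N then c n i else 0); split.
  by move=> n; case: ltnP => _; [exact: hc|exact: ell2_0].
move=> M NM z i; rewrite -(big_mkord xpredT (fun n => z ^+ n * c n i)).
rewrite -(big_mkord xpredT (fun n => z ^+ n * (if (n < N)%N then c n i else 0))).
rewrite [RHS](big_cat_nat (n := N))//= [X in _ = _ + X]big_nat [X in _ = _ + X]big1 ?addr0.
  by rewrite big_nat [RHS]big_nat; apply: eq_bigr => n /andP[_ ->].
by move=> n /andP[Nn _]; rewrite ltnNge Nn mulr0.
Qed.

Lemma H2polyD (I : countType) (q r : C -> I -> C) : H2poly q -> H2poly r ->
  H2poly (fun z i => q z i + r z i).
Proof.
move=> /H2poly_pad[N [c [hc hq]]] /H2poly_pad[M [d [hd hr]]].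
exists (maxn N M), (fun n i => c n i + d n i); split.
  by move=> n; exact: ell2D.
apply/funext => z; apply/funext => i.
rewrite (hq _ (leq_maxl N M)) (hr _ (leq_maxr N M)) -big_split /=.
by apply: eq_bigr => n _; rewrite mulrDr.
Qed.

Lemma H2polyZ (I : countType) a (q : C -> I -> C) : H2poly q ->
  H2poly (fun z i => a * q z i).
Proof.
move=> [N [c [hc ->]]]; exists N, (fun n i => a * c n i); split.
  by move=> n; exact: ell2Z.
apply/funext => z; apply/funext => i; rewrite mulr_sumr.
by apply: eq_bigr => n _; rewrite mulrCA.
Qed.

Lemma H2polyX (I : countType) (q : C -> I -> C) : H2poly q ->
  H2poly (fun z i => z * q z i).
Proof.
move=> [N [c [hc ->]]].
exists N.+1, (fun n => if n is m.+1 then c m else fun=> 0); split.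
  by move=> [|n]; [exact: ell2_0|exact: hc].
apply/funext => z; apply/funext => i; rewrite mulr_sumr big_ord_recl mulr0 add0r.
by apply: eq_bigr => n _; rewrite /= exprS mulrA.
Qed.

Lemma H2poly0 (I : countType) : H2poly (fun (_ : C) (_ : I) => 0 : C).
Proof.
exists 0%N, (fun _ _ => 0); split; first by move=> _; exact: ell2_0.
by apply/funext => z; apply/funext => i; rewrite big_ord0.
Qed.

Lemma H2polyM (I : countType) (p : {poly C}) (q : C -> I -> C) : H2poly q ->
  H2poly (fun z i => p.[z] * q z i).
Proof.
move=> hq; elim/poly_ind: p => [|p c IH].
  have -> : (fun z i => 0.[z] * q z i) = fun _ _ => 0.
    by apply/funext => z; apply/funext => i; rewrite horner0 mul0r.
  exact: H2poly0.
have -> : (fun z i => (p * 'X + c%:P).[z] * q z i) =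
    fun z i => z * (p.[z] * q z i) + c * q z i.
  apply/funext => z; apply/funext => i.
  by rewrite hornerD hornerMX hornerC mulrDl -mulrA mulrCA.
by apply: H2polyD; [exact: H2polyX|exact: H2polyZ].
Qed.

Lemma H2poly_sum (I : countType) (L : Type) (r : seq L) (q : L -> C -> I -> C) :
  (forall l, H2poly (q l)) -> H2poly (fun z i => \sum_(l <- r) q l z i).
Proof.
move=> hq; elim: r => [|l r IH].
  have -> : (fun z i => \sum_(l <- [::]) q l z i) = fun _ _ => 0.
    by apply/funext => z; apply/funext => i; rewrite big_nil.
  exact: H2poly0.
have -> : (fun z i => \sum_(l' <- l :: r) q l' z i) =
    fun z i => q l z i + \sum_(l <- r) q l z i.
  by apply/funext => z; apply/funext => i; rewrite big_cons.
exact: H2polyD.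
Qed.

Lemma H2poly_ell2 (I : countType) (q : C -> I -> C) z : H2poly q -> ell2 (q z).
Proof.
by move=> [N [c [hc ->]]]; apply: ell2_sum => n; apply: ell2Z; exact: hc.
Qed.

Lemma H2poly_csum (I : countType) (f q : C -> I -> C) : H2 f -> H2poly q ->
  exists2 K, 0 <= K & H2le (fun z => csum (fun i => f z i * q z i)) K.
Proof.
move=> hf [N [c [hc ->]]].
have [K K0 hK] := fin_bound (P := fun (n : 'I_N) K =>
   H2le (fun z => csum (fun i => f z i * c n i)) K)
   (fun n K L => @H2le_le _ _ K L) (fun n => H2_csum hf (hc n)).
exists (\sum_(n < N) 1 * K).
  by apply: sumr_ge0 => n _; rewrite mul1r.
apply: (H2le_ext _ (@H2le_sum R _ (index_enum 'I_N) (fun n z => ('X^n).[z] *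
  csum (fun i => f z i * c n i)) (fun=> 1 * K) _ _)).
- move=> z z1; rewrite -csum_sum; last first.
    by move=> n; apply: ell2_abs; [exact: H2_ell2 hf z1|exact: hc].
  congr csum; apply/funext => i; rewrite mulr_sumr; apply: eq_bigr => n _.
  by rewrite hornerXn mulrCA.
- by move=> n; rewrite mul1r.
- move=> n; apply: H2leM (hK n) => // z z1.
  by rewrite hornerXn modulusX z1 expr1n.
Qed.

End Polynomials.

(** * Dimension counts from approximate inverses *)

Section Rank.
Variable R : realType.
Local Notation C := R[i].
Local Notation md := (@modulus R).

(** If [n < m], some row [x != 0] satisfies [x A = 0], hence [x = - x (A B - 1)]. With entries of
    [A B - 1] at most [1 / (2 m)] this halves the l^1 norm of [x]. *)
Lemma approx_right_inverse_le m n (A : 'M[C]_(m, n)) (B : 'M[C]_(n, m)) :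
  (forall a b, 2 * m%:R * md ((A *m B) a b - (a == b)%:R) <= 1) -> (m <= n)%N.
Proof.
move=> hAB; rewrite leqNgt; apply/negP => nm.
have m0 : 0 < 2 * m%:R :> R.
  by rewrite mulr_gt0// ltr0n (leq_ltn_trans _ nm).
have : kermx A != 0.
  rewrite -mxrank_eq0 mxrank_ker subn_eq0 -ltnNge.
  exact: leq_ltn_trans (rank_leq_col A) nm.
move=> /rowV0Pn[x xA x0].
have {}xA : x *m A = 0 by apply/eqP; rewrite -sub_kermx.
have xE b : x 0 b = - \sum_a x 0 a * ((A *m B) a b - (a == b)%:R).
  have : (x *m A *m B) 0 b = 0 by rewrite xA mul0mx mxE.
  rewrite -mulmxA mxE => h0.
  under eq_bigr do rewrite mulrBr.
  rewrite sumrB h0 sub0r opprK (bigD1 b)//= eqxx mulr1 big1 ?addr0// => a /negbTE ->.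
  by rewrite mulr0.
have xle b : 2 * m%:R * md (x 0 b) <= \sum_a md (x 0 a).
  rewrite {1}xE modulusN; apply: (@le_trans _ _ (2 * m%:R *
     \sum_a md (x 0 a * ((A *m B) a b - (a == b)%:R)))).
    by rewrite ler_wpM2l ?(ltW m0)// modulus_sum.
  rewrite mulr_sumr; apply: ler_sum => a _; rewrite modulusM mulrCA.
  by rewrite -[leRHS]mulr1 ler_wpM2l ?modulus_ge0.
have S0 : 0 <= \sum_a md (x 0 a) by apply: sumr_ge0 => a _; exact: modulus_ge0.
have : \sum_(b < m) 2 * m%:R * md (x 0 b) <= m%:R * \sum_a md (x 0 a).
  rewrite [leRHS]mulr_natl -[X in _ <= _ *+ X](card_ord m) -sumr_const.
  by apply: ler_sum => b _.
rewrite -mulr_sumr -mulrA => hS.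
have S1 : \sum_a md (x 0 a) = 0.
  have mm : 0 < m%:R :> R by rewrite ltr0n (leq_ltn_trans _ nm).
  apply/eqP; rewrite eq_le S0 andbT -(ler_pM2l mm) mulr0; lra.
move/eqP: x0; apply; apply/rowP => a; rewrite mxE; apply/eqP.
by rewrite -modulus_eq0; apply/eqP; move: a isT; apply: psumr_eq0P => // a _; exact: modulus_ge0.
Qed.

Lemma bounded_enum (E : countType) d :
  (forall s : seq E, uniq s -> (size s <= d)%N) ->
  exists k (h : 'I_k -> E), injective h /\ forall e, exists l, h l = e.
Proof.
move=> hd; have [s us hs] : exists2 s : seq E, uniq s & forall e, e \in s.
  apply: contrapT => H.
  suff [s us ss] : exists2 s : seq E, uniq s & size s = d.+1.
    by have := hd s us; rewrite ss ltnn.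
  elim: d.+1 => [|n [s us sn]]; first by exists [::].
  have [e es] : exists e, e \notin s.
    apply: contrapT => h; apply: H; exists s => // e; apply/negPn/negP => es.
    by apply: h; exists e.
  by exists (e :: s); rewrite /= ?es ?sn.
exists (size s), (tnth (in_tuple s)); split; first exact/tuple_uniqP.
by move=> e; have /tnthP[l ->] : e \in in_tuple s by []; exists l.
Qed.

End Rank.

(** * Operator functions *)

Section Factorization.
Variable R : realType.
Local Notation C := R[i].
Local Notation md := (@modulus R).

Lemma H2s_col (I J : countType) (F : C -> opmx R I J) j : H2s F ->
  H2 (fun z i => F z i j).
Proof.
move=> [_ _ /(_ _ (ell2_unit R j))].
by under eq_fun do rewrite mxapp_unit.
Qed.

Lemma H2leN f K : 0 <= K -> H2le f K -> H2le (fun z : C => - f z) K.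
Proof.
move=> K0 hf; rewrite -[K]mul1r.
apply: H2le_ext (H2leM (p := (-1)%:P) K0 _ hf) => z z1.
  by rewrite hornerC mulN1r.
by rewrite hornerC modulusN modulus1.
Qed.

Lemma outer_approx (I J : countType) (F : C -> opmx R I J) (e : R) (i : I) :
  outer F -> 0 < e -> exists2 q, H2poly q &
    forall i', H2le (fun z => mxapp (F z) (q z) i' - (i' == i)%:R) e.
Proof.
move=> [_ hF] e0; have [q hq hlt] := hF _ (H2_const (ell2_unit R i)) e e0.
exists q => // i'; have := H2leN (ltW e0) (H2norm_lt_entry i' hlt).
by apply: H2le_ext => z _; rewrite opprB.
Qed.

Section Transpose.
Variables (E : countType) (k : nat) (h : 'I_k -> E).
Hypotheses (h_inj : injective h) (h_surj : forall e, exists l, h l = e).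
Variable Theta : C -> opmx R nat E.
Hypothesis hTheta : H2s Theta.

(** The transpose has finitely many rows, each a column of [Theta] and thus in H^2; all three
    requirements reduce to these rows. *)
Lemma H2s_tr : H2s (fun z => mxtr (Theta z)).
Proof.
have hcol l : H2 (fun z i => Theta z i (h l)) by exact: H2s_col.
split.
- move=> z z1.
  have [K K0 hK] := fin_bound (P := fun l K => sq_le (fun i => Theta z i (h l)) K)
    (fun l K L => @sq_le_mono _ _ _ K L)
    (fun l => (ell2P _).1 (H2_ell2 (hcol l) z1)).
  by exists (k%:R * K); apply: (opnorm_rows h_inj h_surj K0 (lexx _)).
- have /fin_all_exists2[a ha _] := hcol.
  pose g e := sval (cid (h_surj e)).
  have hg e : h (g e) = e by rewrite /g; case: cid.
  have gh l : g (h l) = l by apply: h_inj; rewrite hg.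
  exists (fun n e i => a (g e) n i) => [n|z z1 e e0].
    have [K K0 hK] := fin_bound (P := fun l K => sq_le (a l n) K)
      (fun l K L => @sq_le_mono _ _ _ K L) (fun l => (ell2P _).1 ((ha l).1 n)).
    exists (k%:R * K); apply: (opnorm_rows h_inj h_surj K0 (lexx _)) => l.
    by rewrite gh.
  have k1 : 0 < k%:R + 1 :> R by rewrite ltr_wpDl.
  have e1 : 0 < e / (k%:R + 1) by rewrite divr_gt0.
  have [N0 h0] := fin_eventually (fun l => expansion_remainder (ha l) z1 e1).
  exists N0 => // N /= NN; apply: (opnorm_rows h_inj h_surj (ltW e1)).
    by rewrite mulrCA ler_piMr ?(ltW e0)// ler_pdivrMr// mul1r lerDl.
  by move=> l; rewrite gh; exact: h0.
- move=> x hx; apply: (H2_of_entries h_inj h_surj) => l.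
  exact: H2_csum (hcol l) hx.
Qed.

Definition in_range (m : 'I_k -> C -> C) := exists2 q, H2poly q &
  forall z, in_disk z -> forall l, m l z = mxapp (mxtr (Theta z)) (q z) (h l).

Lemma in_range_H2 m : in_range m -> forall l, exists2 K, 0 <= K & H2le (m l) K.
Proof.
move=> [q hq hm] l; have [K K0 hK] := H2poly_csum (H2s_col (h l) hTheta) hq.
by exists K => //; apply: H2le_ext hK => z z1; rewrite hm.
Qed.

Lemma in_range_lin (I : finType) (m : I -> 'I_k -> C -> C) :
  (forall l, in_range (m l)) ->
  forall c : I -> {poly C}, in_range (fun i z => \sum_l m l i z * (c l).[z]).
Proof.
move=> /fin_all_exists2[q hq hm] c.
exists (fun z i => \sum_l (c l).[z] * q l z i).
  by apply: H2poly_sum => l; exact: H2polyM.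
move=> z z1 i; transitivity (\sum_l (c l).[z] * mxapp (mxtr (Theta z)) (q l z) (h i)).
  by apply: eq_bigr => l _; rewrite hm// mulrC.
rewrite -csum_sum.
  congr csum; apply/funext => j; rewrite mulr_sumr; apply: eq_bigr => l _.
  by rewrite mulrCA.
move=> l; apply: ell2_abs; last exact: H2poly_ell2.
exact: H2_ell2 (H2s_col (h i) hTheta) z1.
Qed.

(** A target [f] is close to a polynomial vector [\sum_l p l e_l], and replacing each [e_l] by a
    nearby vector of the range costs at most [S * e2], with [S] bounding every [p l] on the
    circle. *)
Lemma outer_of_unit_vectors :
  (forall (e : R) j, 0 < e -> exists2 u, in_range u &
     forall i, H2le (fun z => u i z - (i == j)%:R) e) ->
  outer (fun z => mxtr (Theta z)).
Proof.
move=> hu; split; first exact: H2s_tr.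
move=> f hf e e0.
have [Kf [a [Kf0 ha hKf]]] := H2le_family (fun l => H2_entry (h l) hf).
have k1 : 0 < k%:R + 1 :> R by rewrite ltr_wpDl.
pose e1 := e / (k%:R + 1) / 2; have e10 : 0 < e1 by rewrite !divr_gt0.
have [L /(_ _ (leqnn _)) hL] := fin_eventually (fun l => l2_le_tail (hKf l) e10).
pose p l := \poly_(n < L) a l n.
have [S S0 hS] := fin_bound (P := fun l S => forall z, md z = 1 -> md (p l).[z] <= S)
  (fun l K M K0 KM H z z1 => le_trans (H z z1) KM) (fun l => circle_bound (p l)).
have S1 : 0 < S + 1 by rewrite ltr_wpDl.
pose e2 := e1 / (k%:R + 1) / (S + 1); have e20 : 0 < e2 by rewrite !divr_gt0.
have e2k : k%:R * (S * e2) <= e1.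
  have : (k%:R + 1) * (S * e2) <= e1.
    by apply: mul_le_of_divD1; rewrite ?(ltW e20).
  by apply: le_trans; rewrite ler_wpM2r ?lerDl// mulr_ge0// ltW.
have /fin_all_exists2[u hur hue] := fun j => hu e2 j e20.
have [q hq huq] := in_range_lin hur p.
exists q => //.
apply: (H2norm_lt_of_entries h_inj h_surj (K := e1 + \sum_(l < k) S * e2)).
- by rewrite addr_ge0 ?(ltW e10)// sumr_ge0// => l _; rewrite mulr_ge0// ltW.
- rewrite sumr_const card_ord -[S * e2 *+ k]mulr_natl.
  apply: (@le_lt_trans _ _ (k%:R * (e / (k%:R + 1)))).
    by rewrite ler_wpM2l// [leRHS]splitr lerD.
  by rewrite mulrCA gtr_pMr// ltr_pdivrMr// mul1r ltrDl.
move=> i.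
have h1 : H2le (fun z => f z (h i) - (p i).[z]) e1.
  exists (fun n => a i n - (p i)`_n); last exact: hL.
  apply: power_series_ext (power_series_eq _ (power_seriesD (ha i)
    (power_series_poly (- p i)))).
    by move=> z _; rewrite hornerN.
  by move=> n; rewrite coefN.
have h2 := @H2le_sum R _ (index_enum 'I_k)
  (fun l z => (p l).[z] * - (u l i z - (i == l)%:R)) (fun=> S * e2).
have {}h2 : H2le (fun z => \sum_l (p l).[z] * - (u l i z - (i == l)%:R))
    (\sum_(l < k) S * e2).
  apply: h2 => l; first by rewrite mulr_ge0// ltW.
  apply: H2leM; [exact: ltW|exact: hS|].
  by apply: H2leN; [exact: ltW|exact: hue].
apply: H2le_ext (H2leD (ltW e10) _ h1 h2).
  move=> z z1; rewrite -huq//.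
  under eq_bigr do rewrite opprB mulrBr.
  rewrite sumrB (bigD1 i)//= eqxx mulr1 big1 ?addr0; last first.
    by move=> l; rewrite eq_sym => /negbTE ->; rewrite mulr0.
  rewrite addrA subrK; congr (_ - _).
  by apply: eq_bigr => l _; rewrite mulrC.
by apply: sumr_ge0 => l _; rewrite mulr_ge0// ltW.
Qed.

End Transpose.
End Factorization.

Theorem theorem2p1 (R : realType) (d : nat) (hd : (0 < d)%N)
    (F : R[i] -> opmx R nat 'I_d) (hF : H2s F) (hFco : co_outer F)
    (E : countType)
    (Theta : R[i] -> opmx R nat E) (G : R[i] -> opmx R E 'I_d)
    (hTheta : inner Theta) (hG : outer G)
    (hfact : forall z : R[i], in_disk z ->
       forall (i : nat) (j : 'I_d), F z i j = mxmul (Theta z) (G z) i j) :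
  co_outer Theta.
Proof.
have hT : H2s Theta := hTheta.1.
have hGe (e : R) (x : E) : 0 < e -> exists p : 'I_d -> {poly R[i]}, forall y,
    H2le (fun z => \sum_l (p l).[z] * G z y l - (y == x)%:R) e.
  move=> e0; have [q [N [c [hc qE]]] hq] := outer_approx x hG e0.
  exists (fun l => \poly_(n < N) c n l) => y; apply: H2le_ext (hq y) => z z1.
  congr (_ - _); rewrite /mxapp csum_ord; apply: eq_bigr => l _.
  by rewrite mulrC qE horner_poly; congr (_ * _); apply: eq_bigr => n _; rewrite mulrC.
have disk0 : in_disk (0 : R[i]) by rewrite /in_disk modulus0 ltr01.
have hsmall m : (0 < m)%N -> 0 < (2 * m%:R)^-1 :> R.
  by move=> m0; rewrite invr_gt0 mulr_gt0// ltr0n.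
have msmall m (x : R) : (0 < m)%N -> x <= (2 * m%:R)^-1 -> 2 * m%:R * x <= 1.
  move=> m0; have m1 : 0 < 2 * m%:R :> R by rewrite mulr_gt0// ltr0n.
  by rewrite -(ler_pM2l m1) divff ?gt_eqF.
(* Any finite set of rows of [G(0)] has an approximate right inverse with [d] rows, so [E] has at
   most [d] elements. *)
have [k [h [h_inj h_surj]]] : exists k (h : 'I_k -> E),
    injective h /\ forall e, exists l, h l = e.
  apply: (@bounded_enum _ d) => s us.
  have [->//|s0] := posnP (size s).
  have x0 : E by case: (s) s0.
  have /fin_all_exists[p hp] := fun b : 'I_(size s) => hGe _ (nth x0 s b) (hsmall _ s0).
  apply: (@approx_right_inverse_le R _ _ (\matrix_(a, l) G 0 (nth x0 s a) l)
    (\matrix_(l, b) (p b l).[0])) => a b.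
  rewrite mxE; apply: le_trans (msmall _ _ s0 (H2le_at0 (ltW (hsmall _ s0)) (hp b (nth x0 s a)))).
  rewrite nth_uniq//.
  rewrite le_eqVlt; apply/orP; left; apply/eqP; congr (_ * modulus (_ - _)).
  by apply: eq_bigr => l _; rewrite !mxE mulrC.
(* Approximants for the transpose of [F] become approximants for the transpose of [G] once grouped
   as [G^t (Theta^t q)]; the interchange of sums is legitimate because [E] is finite. *)
have hM (e : R) (j : 'I_d) : 0 < e -> exists2 m, in_range h Theta m &
    forall i, H2le (fun z => \sum_l G z (h l) i * m l z - (i == j)%:R) e.
  move=> e0; have [q hq hqe] := outer_approx j hFco e0.
  exists (fun l z => mxapp (mxtr (Theta z)) (q z) (h l)); first by exists q.
  move=> i; apply: H2le_ext (hqe i) => z z1; congr (_ - _).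
  rewrite -csum_sum; last first.
    move=> l; apply: ell2_abs; last exact: H2poly_ell2.
    exact: H2_ell2 (H2s_col (h l) hT) z1.
  congr csum; apply/funext => n; rewrite /mxtr hfact// /mxmul (csum_enum _ h_inj h_surj).
  by rewrite mulr_suml; apply: eq_bigr => l _; rewrite mulrAC mulrC.
have kd : (k <= d)%N.
  have [->//|k0] := posnP k.
  have /fin_all_exists[p hp] := fun b : 'I_k => hGe _ (h b) (hsmall _ k0).
  apply: (@approx_right_inverse_le R _ _ (\matrix_(a, l) G 0 (h a) l)
    (\matrix_(l, b) (p b l).[0])) => a b.
  rewrite mxE; apply: le_trans (msmall _ _ k0 (H2le_at0 (ltW (hsmall _ k0)) (hp b (h a)))).
  rewrite (inj_eq h_inj).
  rewrite le_eqVlt; apply/orP; left; apply/eqP; congr (_ * modulus (_ - _)).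
  by apply: eq_bigr => l _; rewrite !mxE mulrC.
(* The converse count: at 0 the [d] by [k] transpose of [G] has an approximate right inverse. *)
have dk : (d <= k)%N.
  have /fin_all_exists2[m hm hme] := fun j : 'I_d => hM _ j (hsmall _ hd).
  apply: (@approx_right_inverse_le R _ _ (\matrix_(i, l) G 0 (h l) i)
    (\matrix_(l, j) m j l 0)) => a b.
  rewrite mxE; apply: le_trans (msmall _ _ hd (H2le_at0 (ltW (hsmall _ hd)) (hme b a))).
  rewrite le_eqVlt; apply/orP; left; apply/eqP; congr (_ * modulus (_ - _)).
  by apply: eq_bigr => l _; rewrite !mxE.
have {dk}kd : k = d by apply/eqP; rewrite eqn_leq kd dk.
(* Replacing [d] by [k] makes the matrices square, as determinants require. *)
case: d / kd hd F G hF hFco hG hfact hGe hM => hd F G hF hFco hG hfact hGe hM.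
apply: (outer_of_unit_vectors h_inj h_surj hT) => e j e0.
apply: (dense_unit_vectors (A := fun i l z => G z (h l) i)) => //.
- by move=> i l; exact: H2_entry (H2s_col i hG.1).
- exact: in_range_H2 hT.
- exact: in_range_lin.
- move=> e' e'0; have /fin_all_exists[p hp] := fun i => hGe e' (h i) e'0.
  exists p => i l; apply: H2le_ext (hp i (h l)) => z z1.
  by rewrite (inj_eq h_inj) eq_sym.
- by move=> e' e'0; have /fin_all_exists2[m hm hme] := fun j => hM e' j e'0; exists m.
Qed.
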